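(* Suppose that $\inf\varphi(x,z)>-\infty$ and that each $h_i$ is differentiable with locally Lipschitz derivative. Assume further that $\varphi$ has the KL property at any point $(x,z)\in\operatorname{dom}\partial^L\varphi$. If the sequence $\{x^k\}$ generated by the DCA-Like algorithm (described in the context) is bounded, then the whole sequence $\{x^k\}$ converges to a point $x^*$ such that $(x^*,g(x^* ))$ is a critical point of the problem $\min_{(x,z)}\varphi(x,z)$. Moreover, let $\varphi^*=\lim_{k\to\infty}\varphi(x^k,g(x^k))$. If the function $\psi$ appearing in the KL inequality has the form $\psi(s)=cs^{1-\theta}$ with $\theta\in[0,1)$ and $c>0$, then the following statements hold. (i) If $\theta=0$, then the sequences $\{x^k\}$ and $\{\varphi(x^k,g(x^k))\}$ converge in a finite number of steps to $x^*$ and $\varphi^*$, respectively. (ii) If $\theta\in(0,1/2]$, then the sequences $\{x^k\}$ and $\{\varphi(x^k,g(x^k))\}$ converge linearly to $x^*$ and $\varphi^*$, respectively. (iii) If $\theta\in(1/2,1)$, then there exist positive constants $\delta_1,\delta_2$ and $N_0$ such that $$\|x^k-x^*\|\le\delta_1k^{-\frac{1-\theta}{2\theta-1}}\quad\text{and}\quad\varphi(x^k,g(x^k))-\varphi^*\le\delta_2k^{-\frac{1}{2\theta-1}}$$ for all $k\ge N_0$.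
   Context: Setting. $n=\sum_{i=1}^m n_i$, and $x\in\mathbb{R}^n$ is written in blocks $x=(x_1,\dots,x_m)$ with $x_i\in\mathbb{R}^{n_i}$. $X\subset\mathbb{R}^n$ is a closed convex set. $f:\mathbb{R}^n\to\mathbb{R}$ is continuously differentiable (possibly nonconvex) with $L$-Lipschitz continuous gradient. For $i=1,\dots,m$, $g_i:\mathbb{R}^{n_i}\to\mathbb{R}$ is a continuous convex (possibly nonsmooth) function. For $i=1,\dots,m$, $h_i:D_i\to\mathbb{R}$ is concave and increasing (in the sense of nondecreasing), where $D_i\subset\mathbb{R}$ is an open interval, unbounded above, containing $g_i(x_i)$ for all $x\in X$; and the convex subdifferential satisfies $\partial(-h_i)(t)\subset(-\infty,0]$ whenever $t\ge g_i(x_i)$ for some $x\in X$. Notation. $g(x)=(g_1(x_1),\dots,g_m(x_m))\in\mathbb{R}^m$; $\Omega=\{(x,z)\in\mathbb{R}^n\times\mathbb{R}^m: x\in X,\ g_i(x_i)\le z_i,\ i=1,\dots,m\}$; $\chi_\Omega=0$ on $\Omega$ and $+\infty$ elsewhere; $$\varphi(x,z)=\chi_\Omega(x,z)+f(x)+\sum_{i=1}^m h_i(z_i)$$ (equal to $+\infty$ outside $\Omega$). For $\mu>0$: $G_\mu(x,z)=\frac{\mu}{2}\|x\|^2+\chi_\Omega(x,z)$ and $H_\mu(x,z)=\frac{\mu}{2}\|x\|^2-f(x)-\sum_{i=1}^m h_i(z_i)$, so $\varphi=G_\mu-H_\mu$; for $\mu\ge L$ both are convex. Norms are Euclidean. Critical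 point. $(x^*,z^* )$ is a critical point of $\min\varphi$ if $\partial H_\mu(x^*,z^* )\cap\partial G_\mu(x^*,z^* )\neq\emptyset$ (convex subdifferentials) for $\mu\ge L$, $\mu>0$; here $\partial H_\mu(x,z)=\{\mu x-\nabla f(x)\}\times\prod_{i=1}^m\partial(-h_i)(z_i)$, and the condition does not depend on the choice of $\mu$. DCA-Like algorithm. Inputs: $x^0\in X$, $\eta>1$, $0<\delta<1$, $\underline{\mu}>0$. For $k=0,1,2,\dots$ (run without stopping, producing an infinite sequence): 1. Choose $\xi_i^k\in\partial(-h_i)(g_i(x_i^k))$, $i=1,\dots,m$, put $\xi^k=(\xi^k_1,\dots,\xi^k_m)$, and compute $\nabla f(x^k)$. 2. Set $\mu_k=\underline{\mu}$ if $k=0$, and $\mu_k=\max\{\underline{\mu},\delta\mu_{k-1}\}$ if $k>0$. 3. Let $x^{k+1}$ be the minimizer over $x\in X$ of $\frac{\mu_k}{2}\|x-x^k\|^2+\langle\nabla f(x^k),x\rangle+\sum_{i=1}^m(-\xi_i^k)g_i(x_i)$. 4. While $H_{\mu_k}(x^{k+1},g(x^{k+1}))<H_{\mu_k}(x^k,g(x^k))+\langle\mu_kx^k-\nabla f(x^k),x^{k+1}-x^k\rangle+\langle\xi^k,g(x^{k+1})-g(x^k)\rangle$, replace $\mu_k$ by $\eta\mu_k$ and recompute $x^{k+1}$ by step 3. KL (Kurdyka-Lojasiewicz) property. For $\tau\in(0,\infty]$ let $\mathcal{M}_\tau$ be the class of continuous concave functions $\psi:[0,\tau)\to[0,\infty)$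 with $\psi(0)=0$, $\psi$ continuously differentiable on $(0,\tau)$, and $\psi'(t)>0$ for all $t\in(0,\tau)$. $\partial^L\sigma$ denotes the limiting (Mordukhovich) subdifferential of a lower semicontinuous function $\sigma$, $\operatorname{dom}\partial^L\sigma=\{u:\partial^L\sigma(u)\ne\emptyset\}$, and $\operatorname{dist}(0,A)=\inf_{a\in A}\|a\|$ (with $\operatorname{dist}(0,\emptyset)=+\infty$). A lower semicontinuous function $\sigma$ has the KL property at $u^*\in\operatorname{dom}\partial^L\sigma$ if there exist $\tau>0$, a neighborhood $\mathcal{V}$ of $u^*$ and $\psi\in\mathcal{M}_\tau$ such that for all $u\in\mathcal{V}$ with $\sigma(u^* )<\sigma(u)<\sigma(u^* )+\tau$, $$\psi'(\sigma(u)-\sigma(u^* ))\,\operatorname{dist}(0,\partial^L\sigma(u))\ge1 .$$ ''The function $\psi$ appearing in the KL inequality has the form $\psi(s)=cs^{1-\theta}$'' means that in the KL property of $\varphi$ at the points of $\operatorname{dom}\partial^L\varphi$ one can take this $\psi$. Linear convergence of a sequence to a limit means that the distance to the limit at index $k$ is at most $Cq^k$ for all $k$, for some constants $C>0$ and $q\in(0,1)$. *)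

(* Defs.v *)
From HB Require Import structures.
From mathcomp Require Import all_boot all_order all_algebra.
From mathcomp Require Import all_classical all_reals all_analysis.

Set Implicit Arguments.
Unset Strict Implicit.
Unset Printing Implicit Defensive.

Import Order.TTheory GRing.Theory Num.Theory.
Import numFieldNormedType.Exports.

Local Open Scope classical_set_scope.
Local Open Scope ring_scope.

(* The canonical norm of 'rV[R]_n is the sup norm: it is used below only      *)
(* through the topology it induces.  All quantitative statements use [enorm]. *)
Definition dotv (R : realType) (n : nat) (x y : 'rV[R]_n) : R :=
  \sum_(i < n) x 0 i * y 0 i.

Definition enorm (R : realType) (n : nat) (x : 'rV[R]_n) : R :=
  Num.sqrt (dotv x x).

Definition gradient (R : realType) (n : nat) (f : 'rV[R]_n -> R) (x : 'rV[R]_n)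
    : 'rV[R]_n :=
  \row_j 'D_(delta_mx 0 j) f x.

Definition is_argmin (R : realType) (T : Type) (X : set T) (F : T -> R) (y : T)
    : Prop :=
  X y /\ forall x, X x -> F y <= F x.

Definition chi (R : realType) (T : Type) (A : set T) (u : T) : \bar R :=
  if u \in A then 0%E else +oo%E.

(* Convex subdifferential with respect to a pairing [dot]: [dotv] on row      *)
(* vectors, multiplication on the scalars.                                    *)
Definition subdiff (R : realType) (E : zmodType) (dot : E -> E -> R)
    (s : E -> \bar R) (u : E) : set E :=
  [set v | s u \is a fin_num /\
           forall w, (s u + (dot v (w - u))%:E <= s w)%E].

(* liminf_{w -> u} (s w - s u - <v, w - u>) / |w - u| >= 0. *)
Definition frechet_subdiff (R : realType) (n : nat) (s : 'rV[R]_n -> \bar R)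
    (u : 'rV[R]_n) : set 'rV[R]_n :=
  [set v | s u \is a fin_num /\
           forall e : R, 0 < e ->
             \forall w \near u,
               (s u + (dotv v (w - u) - e * enorm (w - u))%:E <= s w)%E].

Definition limiting_subdiff (R : realType) (n : nat) (s : 'rV[R]_n -> \bar R)
    (u : 'rV[R]_n) : set 'rV[R]_n :=
  [set v | s u \is a fin_num /\
           exists (w y : nat -> 'rV[R]_n),
             [/\ w @ \oo --> u,
                 s (w k) @[k --> \oo] --> s u,
                 forall k, frechet_subdiff s (w k) (y k) &
                 y @ \oo --> v]].

(* dist (0, A), equal to +oo when A is empty. *)
Definition dist0 (R : realType) (n : nat) (A : set 'rV[R]_n) : \bar R :=
  ereal_inf [set (enorm a)%:E | a in A].

(* [psi] is total, but only its values on [0, tau) matter; [tau] may be +oo. *)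
Definition desingularizing (R : realType) (tau : \bar R) (psi : R -> R) : Prop :=
  let I := [set t : R | 0 <= t /\ (t%:E < tau)%E] in
  [/\ {within I, continuous psi},
      convex_function I (fun t => - psi t),
      forall t, I t -> 0 <= psi t,
      psi 0 = 0 &
      forall t, 0 < t -> (t%:E < tau)%E ->
        [/\ derivable psi t 1, {for t, continuous (derive1 psi)} & 0 < derive1 psi t]].

Definition KL_with (R : realType) (n : nat) (s : 'rV[R]_n -> \bar R)
    (us : 'rV[R]_n) (psi : R -> R) : Prop :=
  exists (tau : \bar R) (V : set 'rV[R]_n),
    [/\ (0 < tau)%E, nbhs us V, desingularizing tau psi &
        forall u, V u -> (s us < s u)%E -> (s u < s us + tau)%E ->
          (1 <= (derive1 psi (fine (s u - s us)))%:E
                  * dist0 (limiting_subdiff s u))%E].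

Definition KL_property (R : realType) (n : nat) (s : 'rV[R]_n -> \bar R)
    (us : 'rV[R]_n) : Prop :=
  exists psi : R -> R, KL_with s us psi.

Section Problem.
Context {R : realType} {m : nat} {n_ : 'I_m -> nat}.

(* The i-th block of [x] is [submxrow x i]; a pair (x, z) is [row_mx x z]. *)
Local Notation n := (\sum_i n_ i)%N.
Local Notation blocks := 'rV[R]_n.

Definition gvec (g : forall i, 'rV[R]_(n_ i) -> R) (x : blocks) : 'rV[R]_m :=
  \row_i g i (submxrow x i).

Definition lift_pt (g : forall i, 'rV[R]_(n_ i) -> R) (x : blocks)
    : 'rV[R]_(n + m) :=
  row_mx x (gvec g x).

Definition Omega (X : set blocks) (g : forall i, 'rV[R]_(n_ i) -> R)
    : set 'rV[R]_(n + m) :=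
  [set w | X (lsubmx w) /\
           forall i, g i (submxrow (lsubmx w) i) <= rsubmx w 0 i].

(* On [Omega], z_i lies in the domain of h_i; elsewhere [chi] gives +oo. *)
Definition phi (X : set blocks) (f : blocks -> R)
    (g : forall i, 'rV[R]_(n_ i) -> R) (h : 'I_m -> R -> R)
    (w : 'rV[R]_(n + m)) : \bar R :=
  (chi R (Omega X g) w
   + (f (lsubmx w))%:E + (\sum_i h i (rsubmx w 0 i))%R%:E)%E.

(* [- h_i] extended by +oo outside the domain [D i] of [h_i]. *)
Definition neg_ext (h : 'I_m -> R -> R) (D : 'I_m -> set R) (i : 'I_m) (t : R)
    : \bar R :=
  if t \in D i then (- h i t)%:E else +oo%E.

Definition Gfun (X : set blocks) (g : forall i, 'rV[R]_(n_ i) -> R)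
    (mu : R) (w : 'rV[R]_(n + m)) : \bar R :=
  ((mu / 2 * enorm (lsubmx w) ^+ 2)%:E + chi R (Omega X g) w)%E.

Definition Hfun (f : blocks -> R) (h : 'I_m -> R -> R) (D : 'I_m -> set R)
    (mu : R) (w : 'rV[R]_(n + m)) : \bar R :=
  ((mu / 2 * enorm (lsubmx w) ^+ 2 - f (lsubmx w))%:E
   + \sum_i neg_ext h D i (rsubmx w 0%R i))%E.

Definition critical_point (X : set blocks) (f : blocks -> R)
    (g : forall i, 'rV[R]_(n_ i) -> R) (h : 'I_m -> R -> R) (D : 'I_m -> set R)
    (L : R) (w : 'rV[R]_(n + m)) : Prop :=
  forall mu, 0 < mu -> L <= mu ->
    subdiff (@dotv R _) (Hfun f h D mu) w
      `&` subdiff (@dotv R _) (Gfun X g mu) w !=set0.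

Definition model (f : blocks -> R) (g : forall i, 'rV[R]_(n_ i) -> R)
    (mu : R) (xk : blocks) (xi : 'rV[R]_m) (x : blocks) : R :=
  mu / 2 * enorm (x - xk) ^+ 2 + dotv (gradient f xk) x
  + \sum_i (- xi 0 i) * g i (submxrow x i).

Definition rejected (f : blocks -> R) (g : forall i, 'rV[R]_(n_ i) -> R)
    (h : 'I_m -> R -> R) (D : 'I_m -> set R)
    (xk : blocks) (xi : 'rV[R]_m) (mu : R) (y : blocks) : Prop :=
  (Hfun f h D mu (lift_pt g y) <
   Hfun f h D mu (lift_pt g xk)
   + (dotv (mu *: xk - gradient f xk) (y - xk)
      + dotv xi (gvec g y - gvec g xk))%:E)%E.

(* [linesearch .. mu0 mu y]: the while loop entered with parameter [mu0]      *)
(* exits with parameter [mu] and next iterate [y].                            *)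
Inductive linesearch (X : set blocks) (f : blocks -> R)
    (g : forall i, 'rV[R]_(n_ i) -> R) (h : 'I_m -> R -> R) (D : 'I_m -> set R)
    (eta : R) (xk : blocks) (xi : 'rV[R]_m) : R -> R -> blocks -> Prop :=
| LSAccept (mu : R) (y : blocks) :
    is_argmin X (model f g mu xk xi) y ->
    ~ rejected f g h D xk xi mu y ->
    linesearch X f g h D eta xk xi mu mu y
| LSReject (mu mu' : R) (y y' : blocks) :
    is_argmin X (model f g mu xk xi) y ->
    rejected f g h D xk xi mu y ->
    linesearch X f g h D eta xk xi (eta * mu) mu' y' ->
    linesearch X f g h D eta xk xi mu mu' y'.

(* [mu k] is the parameter with which the k-th line search exits. *)
Definition DCA_like (X : set blocks) (f : blocks -> R)
    (g : forall i, 'rV[R]_(n_ i) -> R) (h : 'I_m -> R -> R) (D : 'I_m -> set R)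
    (eta delta mu_low : R)
    (x : nat -> blocks) (xi : nat -> 'rV[R]_m) (mu : nat -> R) : Prop :=
  X (x 0%N) /\
  forall k,
    (forall i, subdiff ( *%R ) (neg_ext h D i) (g i (submxrow (x k) i))
                 (xi k 0 i)) /\
    linesearch X f g h D eta (x k) (xi k)
      (if k is k'.+1 then Num.max mu_low (delta * mu k') else mu_low)
      (mu k) (x k.+1).

End Problem.

(* Main.v *)
Require Import Defs.
From HB Require Import structures.
From mathcomp Require Import all_boot all_order all_algebra.
From mathcomp Require Import all_classical all_reals all_analysis.
From mathcomp Require Import ring lra.

Set Implicit Arguments.
Unset Strict Implicit.
Unset Printing Implicit Defensive.

Import Order.TTheory GRing.Theory Num.Theory.
Import numFieldNormedType.Exports.

Local Open Scope classical_set_scope.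
Local Open Scope ring_scope.

(** Write F(x) = f(x) + sum_i h_i(g_i(x_i)), so that F(x) is the value of phi at
    the lifted point (x, g(x)).

    One step of the algorithm.  Rejection is possible only for mu < L, since
    beyond L the function H_mu is convex; the accepted parameters mu_k therefore
    stay between mu_low and max(mu_low, eta L).  The minimality of x^{k+1} for
    the convex model gives a variational inequality ([model_variational]).
    Tested at x^k and combined with acceptance, it yields the sufficient decrease
    F(x^k) - F(x^{k+1}) >= (mu_low / 2) |x^{k+1} - x^k|^2 ([iterate_descent]).
    Because h_i' >= 0, the same inequality passes from x to all (x, z) of Omega
    and exhibits a Frechet subgradient of phi at (x^{k+1}, g(x^{k+1})), the
    [residual] ([residual_frechet]).  Its two blocks are made of
    mu_k (x^{k+1} - x^k) and of the variations of the gradient of f and of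
    h_i' o g_i between x^k and x^{k+1}, so near any point of X it is at most
    C |x^{k+1} - x^k| ([residual_bound]): convex continuous functions and h_i'
    are locally Lipschitz.

    Cluster point.  Boundedness gives a cluster point p in X.  As F decreases
    and is continuous along X, the gaps r_k = F(x^k) - F(p) are nonnegative and
    tend to 0, hence the steps tend to 0 as well.  Following the
    iterates that come close to p, the residuals vanish: this makes 0 a limiting
    subgradient of phi at (p, g(p)), and the variational inequality in the limit
    is exactly criticality ([stationary_of_approach], [stationary_critical]).

    Convergence.  From here on only three real sequences matter: the distances
    e_k = |x^k - p|, the steps d_k and the gaps r_k.  The KL inequality
    1 <= psi'(r_{k+1}) C d_k and the concavity of psi give
      2 d_{k+1} + (C/a) psi(r_{k+2}) <= d_k + (C/a) psi(r_{k+1}),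
    where a = mu_low / 2 ([KL_step]).  Hence
    e_{k+1} + d_k + (C/a) psi(r_{k+1}) does not increase as long as the
    iterates remain in the KL neighbourhood; starting from a small value, it
    keeps them there, and e_k tends to 0 ([KL_capture]).  The same recursion read
    backwards bounds e_{k+1} by d_k + (C/a) psi(r_{k+1}) ([KL_tail]).

    Rates.  For psi(s) = c s^(1 - theta) the KL inequality reads
    r_{k+1}^theta <= K_0 d_k, and the sufficient decrease turns it into
    r_{k+1}^(2 theta) <= K (r_k - r_{k+1}).  If theta = 0, a positive gap
    would keep the steps away from 0; if 0 < theta <= 1/2, the recursion
    contracts r_k; if theta > 1/2, it makes r_k^(1 - 2 theta) grow at least
    linearly.  The tail bound transfers each rate from the gaps to the
    distances. *)

(** * Euclidean norm and sup-norm topology *)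

Section Euclidean.
Variables (R : realType) (n : nat).
Implicit Types (x y z : 'rV[R]_n) (a : R).

Lemma dotvC x y : dotv x y = dotv y x.
Proof. by apply: eq_bigr => i _; rewrite mulrC. Qed.

Lemma dotvDl x y z : dotv (x + y) z = dotv x z + dotv y z.
Proof. by rewrite -big_split; apply: eq_bigr => i _; rewrite mxE mulrDl. Qed.

Lemma dotvZl a x y : dotv (a *: x) y = a * dotv x y.
Proof. by rewrite mulr_sumr; apply: eq_bigr => i _; rewrite mxE mulrA. Qed.

Lemma dotvNl x y : dotv (- x) y = - dotv x y.
Proof. by rewrite -scaleN1r dotvZl mulN1r. Qed.

Lemma dotvBl x y z : dotv (x - y) z = dotv x z - dotv y z.
Proof. by rewrite dotvDl dotvNl. Qed.

Lemma dotvDr x y z : dotv x (y + z) = dotv x y + dotv x z.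
Proof. by rewrite dotvC dotvDl !(dotvC x). Qed.

Lemma dotvZr a x y : dotv x (a *: y) = a * dotv x y.
Proof. by rewrite dotvC dotvZl (dotvC x). Qed.

Lemma dotvNr x y : dotv x (- y) = - dotv x y.
Proof. by rewrite dotvC dotvNl (dotvC x). Qed.

Lemma dotvBr x y z : dotv x (y - z) = dotv x y - dotv x z.
Proof. by rewrite dotvDr dotvNr. Qed.

Lemma dotv_ge0 x : 0 <= dotv x x.
Proof. by apply: sumr_ge0 => i _; rewrite -expr2 sqr_ge0. Qed.

Lemma enorm_ge0 x : 0 <= enorm x. Proof. exact: sqrtr_ge0. Qed.

Lemma enorm_sqr x : enorm x ^+ 2 = dotv x x.
Proof. by rewrite sqr_sqrtr ?dotv_ge0. Qed.

Lemma enormN x : enorm (- x) = enorm x.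
Proof. by rewrite /enorm dotvNl dotvNr opprK. Qed.

Lemma enormBC x y : enorm (x - y) = enorm (y - x).
Proof. by rewrite -enormN opprB. Qed.

Lemma enormZ a x : enorm (a *: x) = `|a| * enorm x.
Proof.
by rewrite /enorm dotvZl dotvZr mulrA -expr2 sqrtrM ?sqr_ge0// sqrtr_sqr.
Qed.

Lemma enorm_eq0 x : enorm x = 0 -> x = 0.
Proof.
move=> /(congr1 (fun t => t ^+ 2)); rewrite enorm_sqr expr0n /= => /eqP.
rewrite psumr_eq0 => [/allP x0|i _]; last by rewrite -expr2 sqr_ge0.
apply/rowP => i; rewrite mxE; apply/eqP.
by have := x0 i (mem_index_enum i); rewrite -expr2 sqrf_eq0.
Qed.

Lemma enorm0 : enorm (0 : 'rV[R]_n) = 0.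
Proof. by rewrite -(scale0r (0 : 'rV[R]_n)) enormZ normr0 mul0r. Qed.

(** Expand the nonnegative square of | |y| x - |x| y |. *)
Lemma cauchy_schwarz x y : dotv x y <= enorm x * enorm y.
Proof.
have [x0|x0] := eqVneq (enorm x) 0.
  by rewrite (enorm_eq0 x0) -(scale0r (0 : 'rV[R]_n)) dotvZl enormZ normr0 !mul0r.
have [y0|y0] := eqVneq (enorm y) 0.
  by rewrite (enorm_eq0 y0) -(scale0r (0 : 'rV[R]_n)) dotvZr enormZ normr0 !mul0r mulr0.
have xp : 0 < enorm x by rewrite lt_neqAle eq_sym x0 enorm_ge0.
have yp : 0 < enorm y by rewrite lt_neqAle eq_sym y0 enorm_ge0.
have := dotv_ge0 (enorm y *: x - enorm x *: y).
rewrite dotvBl !dotvBr !dotvZl !dotvZr -!enorm_sqr (dotvC y x).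
set s := enorm x in xp *; set t := enorm y in yp *; set d := dotv x y.
have st : 0 < s * t by rewrite mulr_gt0.
move=> H; rewrite -(ler_pM2l st).
nra.
Qed.

Lemma enorm_sqrD x y :
  enorm (x + y) ^+ 2 = enorm x ^+ 2 + 2 * dotv x y + enorm y ^+ 2.
Proof. by rewrite !enorm_sqr dotvDl !dotvDr (dotvC y x); ring. Qed.

Lemma ler_enormD x y : enorm (x + y) <= enorm x + enorm y.
Proof.
rewrite -(ler_pXn2r (ltn0Sn 1)) ?nnegrE ?addr_ge0 ?enorm_ge0//.
rewrite enorm_sqrD; by have := cauchy_schwarz x y; lra.
Qed.

Lemma ler_enormB_trans x y z : enorm (x - z) <= enorm (x - y) + enorm (y - z).
Proof. by have := ler_enormD (x - y) (y - z); rewrite addrA subrK. Qed.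

Lemma dotv_abs x y : `|dotv x y| <= enorm x * enorm y.
Proof.
rewrite ler_norml cauchy_schwarz andbT lerNl -dotvNl.
by apply: le_trans (cauchy_schwarz _ _) _; rewrite enormN.
Qed.

Lemma coord_le_enorm x i : `|x 0 i| <= enorm x.
Proof.
rewrite -sqrtr_sqr ler_wsqrtr// /dotv (bigD1 i)//= -expr2 lerDl.
by apply: sumr_ge0 => j _; rewrite -expr2 sqr_ge0.
Qed.

Lemma enorm_le_sum x : enorm x <= \sum_i `|x 0 i|.
Proof.
have S0 : 0 <= \sum_i `|x 0 i| by apply: sumr_ge0.
rewrite -(ler_pXn2r (ltn0Sn 1)) ?nnegrE ?enorm_ge0// enorm_sqr expr2 mulr_suml.
apply: ler_sum => i _; rewrite -expr2 -real_normK ?num_real// expr2.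
by rewrite ler_wpM2l// (bigD1 i)//= lerDl sumr_ge0.
Qed.

Lemma coord_le_norm x i : `|x 0 i| <= `|x|.
Proof.
rewrite [leRHS]/Num.norm /= mx_normrE.
by apply/bigmax_geP; right; exists (0, i).
Qed.

Lemma norm_le_enorm x : `|x| <= enorm x.
Proof.
rewrite [leLHS]/Num.norm /= mx_normrE; apply/bigmax_leP; split=> [|[i j] _ /=].
  exact: enorm_ge0.
by rewrite ord1 coord_le_enorm.
Qed.

Lemma enorm_le_norm x : enorm x <= n%:R * `|x|.
Proof.
apply: le_trans (enorm_le_sum x) _.
rewrite mulr_natl -[X in _ *+ X]card_ord -sumr_const.
by apply: ler_sum => i _; rewrite coord_le_norm.
Qed.

Lemma near_enorm x (e : R) : 0 < e -> \forall y \near x, enorm (y - x) < e.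
Proof.
move=> e0; have e1 : 0 < e / (n%:R + 1) by rewrite divr_gt0// ltr_wpDl.
have := @nbhsx_ballx _ _ x _ e1; apply: filterS => y; rewrite -ball_normE /=.
rewrite ltr_pdivlMr ?ltr_wpDl// distrC => H; apply: le_lt_trans H.
by apply: le_trans (enorm_le_norm _) _; rewrite mulrC ler_wpM2l// lerDl.
Qed.

(** The topology of the row vectors is that of the sup norm; this lemma and
    [near_enorm] allow working with Euclidean balls only. *)
Lemma nbhs_enormP x (V : set 'rV[R]_n) :
  nbhs x V -> exists2 e : R, 0 < e & forall y, enorm (y - x) < e -> V y.
Proof.
move=> /nbhs_ballP[e /= e0 H]; exists e => // y ye; apply: H.
rewrite -ball_normE /= distrC; apply: le_lt_trans ye; exact: norm_le_enorm.
Qed.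

Lemma near_forall_fin x (I : finType) (P : I -> 'rV[R]_n -> Prop) :
  (forall i, \forall y \near x, P i y) -> \forall y \near x, forall i, P i y.
Proof. exact: (@filter_forall _ I P (nbhs x) (nbhs_filter x)). Qed.

Lemma cvg_enormP (u : nat -> 'rV[R]_n) x :
  (forall e : R, 0 < e -> exists N, forall k, (N <= k)%N -> enorm (u k - x) < e) ->
  u @ \oo --> x.
Proof.
move=> H; apply/cvgrPdist_lt => e e0; have [N HN] := H e e0.
exists N => //= k Nk; rewrite distrC; apply: le_lt_trans (HN k Nk).
exact: norm_le_enorm.
Qed.

End Euclidean.

Lemma dotv_row_mx (R : realType) (n m : nat) (a c : 'rV[R]_n) (b d : 'rV[R]_m) :
  dotv (row_mx a b) (row_mx c d) = dotv a c + dotv b d.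
Proof.
rewrite /dotv big_split_ord /=; congr (_ + _); apply: eq_bigr => i _.
  by rewrite !row_mxEl.
by rewrite !row_mxEr.
Qed.

Lemma dotv_split (R : realType) (n m : nat) (a : 'rV[R]_n) (b : 'rV[R]_m)
    (w : 'rV[R]_(n + m)) :
  dotv (row_mx a b) w = dotv a (lsubmx w) + dotv b (rsubmx w).
Proof. by rewrite -{1}(hsubmxK w) dotv_row_mx. Qed.

Lemma enorm_row_mx (R : realType) (n m : nat) (a : 'rV[R]_n) (b : 'rV[R]_m) :
  enorm (row_mx a b) <= enorm a + enorm b.
Proof.
rewrite -(ler_pXn2r (ltn0Sn 1)) ?nnegrE ?addr_ge0 ?enorm_ge0//.
rewrite enorm_sqr dotv_row_mx -!enorm_sqr.
by have := enorm_ge0 a; have := enorm_ge0 b; nra.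
Qed.

Lemma enorm_lsubmx (R : realType) (n m : nat) (w : 'rV[R]_(n + m)) :
  enorm (lsubmx w) <= enorm w.
Proof.
rewrite ler_wsqrtr// -[in leRHS](hsubmxK w) dotv_row_mx lerDl; exact: dotv_ge0.
Qed.

(** * Convexity and differentiability *)
Section Convexity.
Variables (R : realType) (E : lmodType R).

Lemma convex_functionP (D : set E) (f : E -> R) : convex_function D f ->
  forall (l : R) (x y : E), 0 <= l -> l <= 1 -> D x -> D y ->
    f (l *: x + (1 - l) *: y) <= l * f x + (1 - l) * f y.
Proof.
by move=> cf l x y l0 l1 Dx Dy; apply: (cf (Itv01 l0 l1)); rewrite inE.
Qed.

Lemma convex_setP (D : set E) : convex_set D ->
  forall (l : R) (x y : E), 0 <= l -> l <= 1 -> D x -> D y ->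
    D (l *: x + (1 - l) *: y).
Proof.
move=> cD l x y l0 l1 Dx Dy; rewrite -in_setE.
by apply: (cD x y (Itv01 l0 l1)); rewrite inE.
Qed.

End Convexity.

Section OneDim.
Variable R : realType.
Implicit Types (f : R -> R) (s t : R).

Lemma derivable_expansion f t (e : R) : derivable f t 1 -> 0 < e ->
  \forall w \near t, `|f w - f t - derive1 f t * (w - t)| <= e * `|w - t|.
Proof.
move=> /derivable_nbhs /eqaddoP H e0.
have {H} := H e e0; rewrite /= => H.
rewrite (near_shift 0) /= subr0; apply: filterS H => h /=.
rewrite derive1E -![(_ + _ : _ -> _) _]/(_ + _) -![(- _ : _ -> _) _]/(- _) /cst /=.
have -> : h *: (1 : R) = h by rewrite /GRing.scale /= mulr1.
rewrite addrK -[X in `|_ - X| <= _ -> _]/(f t + h * 'D_1 f t) opprD addrA.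
by rewrite [h * _]mulrC.
Qed.

(** Compare the first-order expansion of f at t with the concavity inequality on
    the segment from t to s, at a point so close to t that the error of the
    expansion is small compared with the distance to t. *)
Lemma concave_tangent (D : set R) f t s :
  convex_function D (fun u => - f u) -> D t -> D s -> derivable f t 1 ->
  f s <= f t + derive1 f t * (s - t).
Proof.
move=> cf Dt Ds df; apply/ler_addgt0Pr => e e0.
have e1 : 0 < e / (`|s - t| + 1) by rewrite divr_gt0// ltr_wpDl.
have [d /= d0 Hd] := (nbhs_ballP _ _).1 (derivable_expansion df e1).
(* This l keeps t + l (s - t) inside the ball of radius d where the expansion
   holds; the + 1 covers the case s = t. *)
pose l := Num.min 1 (d / 2 / (`|s - t| + 1)).
have P0 : 0 < `|s - t| + 1 by rewrite ltr_wpDl.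
have l0 : 0 < l by rewrite lt_min ltr01 !divr_gt0.
have l1 : l <= 1 by rewrite ge_min lexx.
have ld : l * (`|s - t| + 1) <= d / 2 by rewrite -ler_pdivlMr// ge_min lexx orbT.
have bw : ball t d (t + l * (s - t)).
  rewrite /ball /= opprD addrA subrr add0r normrN normrM gtr0_norm//.
  by have := normr_ge0 (s - t); nra.
have := Hd _ bw; rewrite /= [t + _ - t]addrAC subrr add0r => Hw.
have := convex_functionP cf (ltW l0) l1 Ds Dt; rewrite /= /GRing.scale /=.
have -> : l * s + (1 - l) * t = t + l * (s - t) by ring.
move: Hw; rewrite normrM (gtr0_norm l0) ler_norml => /andP[_].
set w := t + _; set A := derive1 f t; move=> Hw Hc.
have Hm : e / (`|s - t| + 1) * `|s - t| <= e.
  by rewrite mulrAC ler_pdivrMr// ler_wpM2l ?ltW// ltrDl.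
rewrite -(ler_pM2l l0); have := ler_wpM2l (ltW l0) Hm; lra.
Qed.

(** First-order optimality along a segment: a is the directional derivative,
    b the coefficient of the quadratic remainder. *)
Lemma small_param_ge0 (a b : R) :
  (forall l, 0 < l -> l <= 1 -> 0 <= l * a + l ^+ 2 * b) -> 0 <= a.
Proof.
move=> H; rewrite leNgt; apply/negP => a0.
pose l := Num.min 1 (- a / (2 * (`|b| + 1))).
have P0 : 0 < 2 * (`|b| + 1) by rewrite mulr_gt0// ltr_wpDl.
have l0 : 0 < l by rewrite lt_min ltr01 divr_gt0// oppr_gt0.
have l1 : l <= 1 by rewrite ge_min lexx.
have ld : l * (2 * (`|b| + 1)) <= - a by rewrite -ler_pdivlMr// ge_min lexx orbT.
have := H l l0 l1; rewrite expr2 -mulrA -mulrDr pmulr_rge0//.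
have := ler_norm b; nra.
Qed.

End OneDim.

Section Gradient.
Variables (R : realType) (n : nat) (f : 'rV[R]_n -> R) (L : R).
Hypothesis f_diff : forall u, differentiable f u.

Lemma derive_gradient u v : 'D_v f u = dotv (gradient f u) v.
Proof.
rewrite deriveE// {1}(row_sum_delta v) linear_sum; apply: eq_bigr => j _.
by rewrite linearZ /= !mxE deriveE// mulrC.
Qed.

Hypothesis f_lip : forall u v,
  enorm (gradient f u - gradient f v) <= L * enorm (u - v).

(** With v = w - u, the function t |-> f(u + t v) - A t - (L/2) |v|^2 t^2 has a
    nonpositive derivative on [0, 1], by the Lipschitz bound on the gradient. *)
Lemma descent_lemma u w :
  f w <= f u + dotv (gradient f u) (w - u) + L / 2 * enorm (w - u) ^+ 2.
Proof.
set v := w - u; set A := dotv _ v.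
pose phi (t : R) := f (u + t *: v) - (A * t + L / 2 * enorm v ^+ 2 * t ^+ 2).
pose dphi (t : R) := dotv (gradient f (u + t *: v)) v - (A + L * enorm v ^+ 2 * t).
have dl (t : R) : is_derive t 1 (fun t => f (u + t *: v))
    (dotv (gradient f (u + t *: v)) v).
  have E : (fun h : R => h^-1 *: (((fun t => f (u + t *: v)) \o shift t) (h *: 1)
               - f (u + t *: v))) =
      (fun h : R => h^-1 *: ((f \o shift (u + t *: v)) (h *: v) - f (u + t *: v))).
    apply/funext => h /=; congr (_ *: (f _ - _)).
    by rewrite [h *: 1]mulr1 scalerDl addrCA.
  have := @diff_derivable _ _ _ _ _ v (f_diff (u + t *: v)).
  rewrite -derive_gradient /derivable -E => dv; apply: DeriveDef => //.
  by rewrite /derive E.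
have dp (t : R) : is_derive t 1 phi (dphi t).
  rewrite /phi /dphi.
  have -> : (fun t : R => f (u + t *: v) - (A * t + L / 2 * enorm v ^+ 2 * t ^+ 2)) =
      (fun t => f (u + t *: v)) - (A \*: id + (L / 2 * enorm v ^+ 2) \*: id ^+ 2).
    by apply/funext => s.
  apply: is_derive_eq; rewrite /= /GRing.scale /=.
  by field.
have [c c01 E] : exists2 c, c \in `[0, 1]%R & phi 1 - phi 0 = dphi c * (1 - 0).
  apply: MVT_segment => //.
  by apply: derivable_within_continuous => t _.
have c0 : 0 <= c by move: c01; rewrite in_itv => /andP[].
suff : phi 1 <= phi 0.
  rewrite /phi scale0r addr0 scale1r /v subrKC expr0n expr1n /=; lra.
rewrite -subr_le0 E subr0 mulr1 /dphi subr_le0 -lerBlDl -dotvBl.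
apply: le_trans (cauchy_schwarz _ _) _.
apply: le_trans (ler_wpM2r (enorm_ge0 _) (f_lip _ _)) _.
by rewrite addrAC subrr add0r enormZ ger0_norm// expr2; lra.
Qed.

(** Exchange u and w in [descent_lemma]; replacing the gradient at w by the one
    at u costs L |w - u|^2 more, whence the constant 3 L / 2 rather than L / 2. *)
Lemma descent_lemma_lower u w :
  f u + dotv (gradient f u) (w - u) - L * 3 / 2 * enorm (w - u) ^+ 2 <= f w.
Proof.
have := descent_lemma w u; rewrite enormBC -(opprB w u) dotvNr => H.
have : dotv (gradient f u - gradient f w) (w - u) <= L * enorm (w - u) ^+ 2.
  apply: le_trans (cauchy_schwarz _ _) _.
  by rewrite expr2 mulrA ler_wpM2r ?enorm_ge0// (le_trans (f_lip _ _))// enormBC.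
rewrite dotvBl; lra.
Qed.

End Gradient.

(** By continuity g oscillates by less than 2 on a ball of radius 2 rho.  For u, v
    in the concentric ball of radius rho, prolong the segment from u to v by rho
    beyond v, up to v': convexity along [u, v'] bounds g(v) - g(u) by
    2 |v - u| / rho. *)
Lemma convex_locally_lipschitz (R : realType) (n : nat) (g : 'rV[R]_n -> R) x :
  {for x, continuous g} -> convex_function setT g ->
  exists K rho : R, [/\ 0 <= K, 0 < rho & forall u v,
    enorm (u - x) < rho -> enorm (v - x) < rho ->
    `|g u - g v| <= K * enorm (u - v)].
Proof.
move=> gc gcvx.
have [e e0 He] : exists2 e : R, 0 < e & forall y, enorm (y - x) < e -> `|g y - g x| < 1.
  apply: nbhs_enormP; move/cvgrPdist_lt : gc => /(_ 1 ltr01).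
  by apply: filterS => y; rewrite distrC.
pose rho := e / 2; have r0 : 0 < rho by rewrite divr_gt0.
exists (2 / rho), rho; split=> //; first by rewrite divr_ge0// ltW.
have H u v : enorm (u - x) < rho -> enorm (v - x) < rho ->
    g v - g u <= 2 / rho * enorm (v - u).
  move=> ux vx; have [t0|t0] := eqVneq (enorm (v - u)) 0.
    by move/enorm_eq0/subr0_eq : (t0) => ->; rewrite !subrr enorm0 mulr0.
  set t := enorm (v - u) in t0 *.
  have {}t0 : 0 < t by rewrite lt_neqAle eq_sym t0 enorm_ge0.
  pose v' := v + (rho / t) *: (v - u).
  have v'x : enorm (v' - x) < e.
    rewrite /v' addrAC; apply: le_lt_trans (ler_enormD _ _) _.
    rewrite enormZ -/t ger0_norm ?divr_ge0 ?(ltW e0) ?(ltW t0)//.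
    by rewrite divfK ?gt_eqF// (splitr e) ltrD2r.
  have ue : enorm (u - x) < e.
    by apply: lt_le_trans ux _; rewrite /rho ler_pdivrMr//; lra.
  have rt : 0 < rho + t by rewrite addr_gt0.
  pose l := t / (rho + t).
  have l0 : 0 <= l by rewrite divr_ge0 ?(ltW rt) ?(ltW t0).
  have l1 : l <= 1 by rewrite ler_pdivrMr// mul1r lerDr ltW.
  have lt : l <= t / rho by rewrite ler_pM2l// lef_pV2 ?posrE// lerDl ltW.
  have Ev : l *: v' + (1 - l) *: u = v.
    apply/rowP => i; rewrite !mxE /l.
    by field; rewrite !gt_eqF.
  have := convex_functionP gcvx l0 l1 (x := v') (y := u) I I; rewrite Ev.
  have := He _ v'x; have := He _ ue; rewrite !ltr_norml => /andP[a1 _] /andP[_ a2] a3.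
  have : l * (g v' - g u) <= t / rho * 2.
    apply: (le_trans (y := l * 2)); last by rewrite ler_wpM2r.
    by rewrite ler_wpM2l//; lra.
  have -> : 2 / rho * t = t / rho * 2 by rewrite mulrAC [RHS]mulrAC (mulrC 2).
  by move=> a4; lra.
move=> u v ux vx; rewrite ler_norml H// andbT lerNl opprB enormBC; exact: H.
Qed.

(** The subgradient inequality on both sides of t squeezes v + h_i'(t) between
    -e and e for every e > 0. *)
Lemma subdiff_neg_ext (R : realType) (m : nat) (h : 'I_m -> R -> R)
    (D : 'I_m -> set R) i (t v : R) :
  open (D i) -> D i t -> derivable (h i) t 1 ->
  subdiff ( *%R ) (neg_ext h D i) t v -> v = - derive1 (h i) t.
Proof.
move=> Dopen Dt dh [_ Hv]; apply/eqP; rewrite -subr_eq0 opprK -normr_le0.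
apply/ler_addgt0Pr => e e0; rewrite add0r.
have /nbhs_ballP[d /= d0 Hd] : \forall w \near t, D i w /\
    `|h i w - h i t - derive1 (h i) t * (w - t)| <= e * `|w - t|.
  apply: filterI; first exact: open_nbhs_nbhs.
  exact: derivable_expansion.
have Hw w : ball t d w -> (v + derive1 (h i) t) * (w - t) <= e * `|w - t|.
  move=> /Hd[Dw]; rewrite ler_norml => /andP[B _]; have := Hv w.
  rewrite /neg_ext !mem_set// -EFinD lee_fin; lra.
have d2 : 0 < d / 2 by rewrite divr_gt0.
have := Hw (t + d / 2); have := Hw (t - d / 2).
rewrite /ball /= opprD opprK addrA subrr add0r [t - _ - t]addrAC subrr add0r.
rewrite opprD addrA subrr add0r [t + _ - t]addrAC subrr add0r !normrN gtr0_norm//.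
have dd : d / 2 < d by rewrite ltr_pdivrMr//; lra.
move=> /(_ dd) A1 /(_ dd) A2; rewrite ler_norml.
apply/andP; split; rewrite -(ler_pM2r d2); lra.
Qed.

(** * Scalar recursions *)
Lemma geometric_extend (R : realType) (s : nat -> R) (C q : R) :
  0 <= C -> 0 < q -> (\forall k \near \oo, s k <= C * q ^+ k) ->
  exists2 C', 0 < C' & forall k, s k <= C' * q ^+ k.
Proof.
move=> C0 q0 [N _ HN].
have S0 : 0 <= \sum_(j < N) `|s j| / q ^+ j.
  by apply: sumr_ge0 => j _; rewrite divr_ge0// exprn_ge0// ltW.
exists (C + 1 + \sum_(j < N) `|s j| / q ^+ j); first lra.
move=> k; have qk : 0 < q ^+ k by rewrite exprn_gt0.
have [Nk|kN] := leqP N k.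
  by apply: le_trans (HN k Nk) _; rewrite ler_wpM2r ?ltW//; lra.
rewrite -ler_pdivrMr//; apply: (le_trans (y := `|s k| / q ^+ k)).
  by rewrite ler_wpM2r ?ler_norm// invr_ge0 ltW.
rewrite (bigD1 (Ordinal kN))//=.
have : 0 <= \sum_(i < N | i != Ordinal kN) `|s i| / q ^+ i.
  by apply: sumr_ge0 => j _; rewrite divr_ge0// exprn_ge0// ltW.
lra.
Qed.

Lemma contraction_geometric (R : realType) (r : nat -> R) (q : R) :
  0 < q -> (forall k, 0 <= r k) -> (\forall k \near \oo, r k.+1 <= q * r k) ->
  exists2 C, 0 <= C & \forall k \near \oo, r k <= C * q ^+ k.
Proof.
move=> q0 r0 [N _ HN]; have qN : 0 < q ^+ N by rewrite exprn_gt0.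
exists (r N / q ^+ N); first by rewrite divr_ge0// ltW.
exists N => // k Nk; rewrite -(subnKC Nk) exprD mulrA divfK ?gt_eqF//.
elim: (k - N)%N => [|j IH]; first by rewrite addn0 expr0 mulr1.
rewrite addnS exprS mulrCA; apply: le_trans (HN _ (leq_addr _ _)) _.
by rewrite ler_wpM2l// ltW.
Qed.

(** Discrete form of the differential inequality r' <= - r^(1 + p) / K, whose
    solutions satisfy (r^(-p))' >= p / K.  With y = t^p / K <= 1 the hypothesis
    says s >= t (1 + y), and (1 + y)^p >= 1 + p y / 2; inverting, s^(-p) is at
    most t^(-p) (1 - p y / 4) = t^(-p) - p / (4 K). *)
Lemma negative_power_increase (R : realType) (p K s t : R) :
  0 < p -> p <= 1 -> 1 <= K -> 0 < t -> t <= 1 -> t `^ (1 + p) <= K * (s - t) ->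
  s `^ (- p) + p / (4 * K) <= t `^ (- p).
Proof.
move=> p0 p1 K1 t0 t1 H; have K0 : 0 < K by lra.
have tp : 0 < t `^ p by exact: powR_gt0.
have tp1 : t `^ p <= 1.
  by rewrite -(@powRr0 R t); apply: ger_powR (ltW p0); rewrite t0.
pose y := t `^ p / K.
have y0 : 0 < y by rewrite divr_gt0.
have y1 : y <= 1 by rewrite ler_pdivrMr//; lra.
have ts : t * (1 + y) <= s.
  have E : t `^ (1 + p) = t * t `^ p.
    by rewrite powRD ?powRr1 ?ltW//; apply/implyP => _; rewrite gt_eqF.
  have : t * y <= s - t by rewrite /y mulrA ler_pdivrMr// -E [leRHS]mulrC.
  lra.
have ln1y : y / 2 <= ln (1 + y).
  have y10 : 0 < 1 + y by lra.
  rewrite -[ln _]opprK -lnV ?posrE// lerNr.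
  have -> : (1 + y)^-1 = 1 + (- (y / (1 + y))) by field; lra.
  apply: (le_trans (le_ln1Dx _)).
    by rewrite ltrN2 ltr_pdivrMr// mul1r; lra.
  by rewrite lerN2 ler_pM2l// lef_pV2 ?posrE//; lra.
have pow1y : 1 + p * y / 2 <= (1 + y) `^ p.
  rewrite /powR gt_eqF; last lra.
  apply: le_trans (expR_ge1Dx _); rewrite lerD2l -mulrA ler_wpM2l// ltW//.
have s0 : 0 < s by apply: lt_le_trans ts; rewrite mulr_gt0//; lra.
have sp : t `^ p * (1 + p * y / 2) <= s `^ p.
  apply: (le_trans (y := t `^ p * (1 + y) `^ p)); first by rewrite ler_wpM2l ?(ltW tp).
  rewrite -powRM ?(ltW t0)//; last lra.
  apply: ge0_ler_powR; rewrite ?nnegrE ?(ltW p0) ?(ltW s0)//.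
  by rewrite mulr_ge0 ?(ltW t0)//; lra.
have py0 : 0 < p * y by rewrite mulr_gt0.
have py1 : p * y <= 1 by rewrite mulr_ile1 ?(ltW p0) ?(ltW y0).
rewrite !powRN.
have : (s `^ p)^-1 <= (t `^ p)^-1 * (1 - p * y / 4).
  have inv1 : (s `^ p)^-1 <= (t `^ p * (1 + p * y / 2))^-1.
    by rewrite lef_pV2 ?posrE ?powR_gt0// mulr_gt0//; lra.
  apply: le_trans inv1 _; rewrite invfM ler_wpM2l ?invr_ge0 ?(ltW tp)//.
  rewrite -[leLHS]mul1r ler_pdivrMr; last lra.
  nra.
have -> : (t `^ p)^-1 * (1 - p * y / 4) = (t `^ p)^-1 - p / (4 * K).
  by rewrite /y; field; rewrite !gt_eqF.
lra.
Qed.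

Lemma powR_neg_anti (R : realType) (x y p : R) :
  0 < x -> x <= y -> 0 <= p -> y `^ (- p) <= x `^ (- p).
Proof.
move=> x0 xy p0; have y0 : 0 < y by apply: lt_le_trans xy.
rewrite !powRN lef_pV2 ?posrE ?powR_gt0//.
by apply: ge0_ler_powR; rewrite ?nnegrE ?(ltW x0) ?(ltW y0).
Qed.

(** The three regimes for distances e and gaps r; a single pair (C, q)
    serves both sequences in the linear regime. *)
Definition KL_rates (R : realType) (theta : R) (e r : nat -> R) :=
  [/\ theta = 0 ->
        exists N : nat, forall k, (N <= k)%N -> e k = 0 /\ r k = 0,
      0 < theta -> theta <= 1 / 2 ->
        exists C q, [/\ 0 < C, 0 < q, q < 1 &
          forall k, e k <= C * q ^+ k /\ r k <= C * q ^+ k] &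
      1 / 2 < theta ->
        exists (delta1 delta2 : R) (N0 : nat),
          [/\ 0 < delta1, 0 < delta2, (0 < N0)%N & forall k, (N0 <= k)%N ->
            e k <= delta1 * k%:R `^ (- ((1 - theta) / (2 * theta - 1))) /\
            r k <= delta2 * k%:R `^ (- (1 / (2 * theta - 1)))]].

(** * Descent sequences under a Kurdyka-Lojasiewicz inequality *)
Section DescentSequences.
Variables (R : realType) (e d r : nat -> R) (a : R).
Hypothesis a_gt0 : 0 < a.
Hypothesis e_ge0 : forall k, 0 <= e k.
Hypothesis d_ge0 : forall k, 0 <= d k.
Hypothesis r_ge0 : forall k, 0 <= r k.
Hypothesis descent : forall k, a * d k ^+ 2 <= r k - r k.+1.
Hypothesis e_up : forall k, e k.+1 <= e k + d k.
Hypothesis e_down : forall k, e k <= e k.+1 + d k.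
Hypothesis r_lim : forall eps, 0 < eps -> \forall k \near \oo, r k < eps.

Lemma step_le_value k : a * d k ^+ 2 <= r k.
Proof. by have := descent k; have := r_ge0 k.+1; lra. Qed.

Lemma value_decr k : r k.+1 <= r k.
Proof. by have := descent k; have := mulr_ge0 (ltW a_gt0) (sqr_ge0 (d k)); lra. Qed.

Lemma step_lim eps : 0 < eps -> \forall k \near \oo, d k < eps.
Proof.
move=> eps0; have := r_lim (mulr_gt0 a_gt0 (exprn_gt0 2 eps0)).
apply: filterS => k H; rewrite -(ltr_pXn2r (ltn0Sn 1)) ?nnegrE ?(ltW eps0)//.
by rewrite -(ltr_pM2l a_gt0); apply: le_lt_trans H; exact: step_le_value.
Qed.

Section KLInequality.
Variables (C rho : R) (tau : \bar R) (psi : R -> R).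
Hypothesis C_gt0 : 0 < C.
Hypothesis rho_gt0 : 0 < rho.
Hypothesis e_freq : forall eps, 0 < eps -> forall N, exists2 k, (N <= k)%N & e k < eps.
Hypothesis tau_gt0 : (0 < tau)%E.
Hypothesis psi_desing : desingularizing tau psi.
Hypothesis KL : forall k, e k < rho -> e k.+1 < rho -> 0 < r k.+1 ->
  ((r k.+1)%:E < tau)%E -> 1 <= derive1 psi (r k.+1) * (C * d k).

Lemma value_lt_tau : \forall k \near \oo, ((r k)%:E < tau)%E.
Proof.
case: tau tau_gt0 => [t|_|]//; last by near=> k; exact: ltry.
by rewrite lte_fin => /r_lim; apply: filterS => k; rewrite lte_fin.
Unshelve. all: by end_near. Qed.

Lemma psi_value_lim eps : 0 < eps -> \forall k \near \oo, psi (r k) < eps.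
Proof.
move=> eps0; have [psic _ _ psi0 _] := psi_desing.
have := (subspace_continuousP _ _).1 psic 0 (conj (lexx 0) tau_gt0).
rewrite /from_subspace psi0 => /cvgrPdist_lt /(_ _ eps0).
rewrite /prop_near1 /within /= => /nbhs_ballP[t /= t0 Ht].
have [N _ HN] := filterI value_lt_tau (r_lim t0); exists N => // k Nk.
have [rt rk] := HN k Nk.
have := Ht (r k); rewrite /ball /= !sub0r !normrN ger0_norm// => /(_ rk (conj (r_ge0 k) rt)).
by rewrite ltr_norml => /andP[].
Qed.

(** Concavity of psi and the KL inequality give
    d_{k+1}^2 <= d_k y with y = (C/a) (psi(r_{k+1}) - psi(r_{k+2})), and
    2 sqrt(d_k y) <= d_k + y.  If r_{k+1} = 0 the KL inequality says nothing,
    but then d_{k+1} = r_{k+2} = 0. *)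
Lemma KL_step k : e k < rho -> e k.+1 < rho -> ((r k.+1)%:E < tau)%E ->
  2 * d k.+1 + C / a * psi (r k.+2) <= d k + C / a * psi (r k.+1).
Proof.
move=> ek ek1 rt; have Ca : 0 < C / a by rewrite divr_gt0.
have r12 := descent k.+1.
have r2 := r_ge0 k.+2; have d1 := d_ge0 k.+1; have d0 := d_ge0 k.
have [_ psicvx psige0 psi0 psid] := psi_desing.
have [r0|r0] := eqVneq (r k.+1) 0.
  have : 0 <= a * d k.+1 ^+ 2 by rewrite mulr_ge0 ?sqr_ge0// ltW.
  rewrite r0 sub0r in r12 => ad.
  have -> : r k.+2 = 0 by lra.
  have : a * d k.+1 ^+ 2 == 0 by apply/eqP; lra.
  by rewrite mulf_eq0 gt_eqF//= sqrf_eq0 => /eqP ->; rewrite r0; lra.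
have rp : 0 < r k.+1 by rewrite lt_neqAle eq_sym r0 r_ge0.
have [psider _ psip] := psid _ rp rt.
have r2t : ((r k.+2)%:E < tau)%E.
  by apply: le_lt_trans rt; rewrite lee_fin value_decr.
have := concave_tangent psicvx (conj (ltW rp) rt) (conj r2 r2t) psider.
have := KL ek ek1 rp rt.
set p := derive1 psi _ in psip *; set D1 := psi (r k.+1); set D2 := psi (r k.+2).
move=> KL1 tan.
have H1 : p * (a * d k.+1 ^+ 2) <= D1 - D2.
  by have := ler_wpM2l (ltW psip) r12; lra.
have H2 : d k.+1 ^+ 2 <= d k * (C / a * (D1 - D2)).
  apply: (le_trans (y := d k.+1 ^+ 2 * (p * (C * d k)))).
    by rewrite ler_peMr// sqr_ge0.
  have -> : d k.+1 ^+ 2 * (p * (C * d k)) = C / a * d k * (p * (a * d k.+1 ^+ 2)).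
    by field; rewrite gt_eqF.
  rewrite [leRHS]mulrCA mulrA ler_wpM2l// mulr_ge0// ltW//.
have y0 : 0 <= C / a * (D1 - D2).
  rewrite mulr_ge0 ?(ltW Ca)//; apply: le_trans H1.
  by rewrite mulr_ge0 ?(ltW psip)// mulr_ge0 ?sqr_ge0// ltW.
set y := C / a * (D1 - D2) in H2 y0.
have : 2 * d k.+1 <= d k + y.
  rewrite -(ler_pXn2r (ltn0Sn 1)) ?nnegrE; [|lra|lra].
  by have := sqr_ge0 (d k - y); lra.
by rewrite /y; lra.
Qed.

(** The potential Q decreases along every step taken inside the ball of radius
    rho and dominates e_{k+1}: once Q is below eps, the next iterate is still
    in the ball and the argument repeats forever. *)
Lemma KL_capture eps : 0 < eps -> \forall k \near \oo, e k < eps.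
Proof.
move=> eps0; wlog le_eps : eps eps0 / eps <= rho => [H|].
  have m0 : 0 < Num.min eps rho by rewrite lt_min eps0.
  have := H _ m0; rewrite ge_min lexx orbT => /(_ isT).
  by apply: filterS => k; rewrite lt_min => /andP[].
have e4 : 0 < eps / 4 by rewrite divr_gt0.
have Ca : 0 < C / a by rewrite divr_gt0.
have [N _ HN] := filterI value_lt_tau (filterI (step_lim e4)
   (psi_value_lim (divr_gt0 e4 Ca))).
have [k0 Nk0 ek0] := e_freq e4 N.
pose Q k := e k.+1 + (d k + C / a * psi (r k.+1)).
have eQ k : (N <= k)%N -> e k.+1 <= Q k.
  move=> Nk; rewrite /Q lerDl addr_ge0// mulr_ge0 ?(ltW Ca)//.
  have [_ _ psige0 _ _] := psi_desing; apply: psige0; split => //.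
  by have [] := HN k.+1 (leqW Nk).
have Q0 : Q k0 < eps.
  have [_ [d0 _]] := HN k0 Nk0; have [_ [_ p0]] := HN k0.+1 (leqW Nk0).
  have : C / a * psi (r k0.+1) < eps / 4 by rewrite mulrC -ltr_pdivlMr.
  by have := e_up k0; rewrite /Q; lra.
have H j : e (k0 + j)%N < eps /\ Q (k0 + j)%N <= Q k0.
  elim: j => [|j [IHe IHQ]]; first by rewrite addn0; split=> //; lra.
  have Nk : (N <= k0 + j)%N by rewrite (leq_trans Nk0)// leq_addr.
  have ej : e (k0 + j).+1 < eps.
    by apply: le_lt_trans Q0; apply: le_trans IHQ; exact: eQ.
  rewrite addnS; split=> //; apply: le_trans IHQ.
  have := KL_step (lt_le_trans IHe le_eps) (lt_le_trans ej le_eps).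
  have [rt _] := HN (k0 + j).+1 (leqW Nk); move=> /(_ rt).
  by have := e_up (k0 + j).+1; rewrite /Q; lra.
exists k0 => //= k k0k; rewrite -(subnKC k0k); exact: (H _).1.
Qed.

(** By [KL_step], e_{k+1} - P_k is nondecreasing; its limit is at most 0 because
    e tends to 0 and P is nonnegative. *)
Lemma KL_tail : \forall k \near \oo, e k.+1 <= d k + C / a * psi (r k.+1).
Proof.
have Ca : 0 < C / a by rewrite divr_gt0.
have [N _ HN] := filterI value_lt_tau (KL_capture rho_gt0).
exists N => // k Nk; apply/ler_addgt0Pr => eps eps0.
pose P k := d k + C / a * psi (r k.+1).
have mono j : e k.+1 - P k <= e (k + j).+1 - P (k + j)%N.
  elim: j => [|j IH]; first by rewrite addn0.
  apply: le_trans IH _; have Nkj : (N <= k + j)%N by rewrite (leq_trans Nk)// leq_addr.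
  have [_ e1] := HN _ Nkj; have [r2 e2] := HN _ (leqW Nkj).
  by rewrite addnS; have := KL_step e1 e2 r2; have := e_down (k + j).+1; rewrite /P; lra.
have [M _ HM] := KL_capture eps0.
have := mono M; have := HM (k + M).+1; rewrite /= => /(_ _)H.
have {}H := H (leqW (leq_addl _ _)).
have : 0 <= P (k + M)%N.
  rewrite addr_ge0// mulr_ge0 ?(ltW Ca)//.
  have [_ _ psige0 _ _] := psi_desing; apply: psige0; split => //.
  by have [] := HN (k + M).+1 (leqW (leq_trans Nk (leq_addr _ _))).
by rewrite /P; lra.
Qed.

End KLInequality.

Lemma derive1_power (c theta t : R) : 0 < t ->
  derive1 (fun s => c * s `^ (1 - theta)) t = c * (1 - theta) * t `^ (- theta).
Proof.
move=> t0; rewrite derive1E.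
have -> : (fun s => c * s `^ (1 - theta)) = c \*: (@powR R ^~ (1 - theta)) by [].
have D := is_derive1_powR (1 - theta) t0.
rewrite (derive_val (is_derive := is_deriveZ c D)).
by rewrite /GRing.scale /= mulrA; congr (_ * _ `^ _); lra.
Qed.

(** For a power psi, psi'(r) C d >= 1 becomes an upper bound on r^theta.  The
    estimate of e_k follows from [KL_tail] and d_k <= sqrt(r_k / a). *)
Lemma power_KL_estimates (C rho : R) (tau : \bar R) (c theta : R) :
  0 < C -> 0 < rho -> 0 < c -> 0 <= theta -> theta < 1 ->
  (forall eps, 0 < eps -> forall N, exists2 k, (N <= k)%N & e k < eps) ->
  (0 < tau)%E -> desingularizing tau (fun s => c * s `^ (1 - theta)) ->
  (forall k, e k < rho -> e k.+1 < rho -> 0 < r k.+1 -> ((r k.+1)%:E < tau)%E ->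
     1 <= derive1 (fun s => c * s `^ (1 - theta)) (r k.+1) * (C * d k)) ->
  exists K0 K1 K2 : R, [/\ 0 < K0, 0 <= K1, 0 <= K2,
    \forall k \near \oo, 0 < r k.+1 -> r k.+1 `^ theta <= K0 * d k &
    \forall k \near \oo, e k <= K1 * r k `^ (1 / 2) + K2 * r k `^ (1 - theta)].
Proof.
move=> C0 rho0 c0 th0 th1 freq tau0 desing KL.
have th2 : 0 < 1 - theta by lra.
have sa : 0 < Num.sqrt a by rewrite sqrtr_gt0.
exists (c * (1 - theta) * C), (2 / Num.sqrt a), (C / a * c); split.
- by rewrite !mulr_gt0.
- by rewrite divr_ge0// ltW.
- by rewrite !mulr_ge0 ?invr_ge0// ltW.
- have [N _ HN] := filterI (value_lt_tau tau0) (KL_capture C0 rho0 freq tau0 desing KL rho0).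
  exists N => // k Nk rp.
  have [_ e1] := HN k Nk; have [t2 e2] := HN k.+1 (leqW Nk).
  have := KL k e1 e2 rp t2; rewrite derive1_power// powRN.
  set q := r k.+1 `^ theta => H; have q0 : 0 < q by exact: powR_gt0.
  have {}H := ler_wpM2l (ltW q0) H; rewrite mulr1 in H.
  apply: le_trans H _; rewrite le_eqVlt; apply/orP; left; apply/eqP.
  by field; rewrite gt_eqF.
- have [N _ HN] := KL_tail C0 rho0 freq tau0 desing KL.
  exists N => // k Nk; have t1 := HN k Nk.
  have dk : d k <= (Num.sqrt a)^-1 * r k `^ (1 / 2).
    rewrite div1r powR12_sqrt// ler_pdivlMl// mulrC.
    rewrite -(ler_pXn2r (ltn0Sn 1)) ?nnegrE ?mulr_ge0 ?sqrtr_ge0//.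
    rewrite exprMn !sqr_sqrtr ?(ltW a_gt0)// mulrC; exact: step_le_value.
  have rk : r k.+1 `^ (1 - theta) <= r k `^ (1 - theta).
    apply: ge0_ler_powR; rewrite ?nnegrE ?r_ge0 ?(ltW th2)//.
    exact: value_decr.
  have Cc : 0 <= C / a * c by rewrite !mulr_ge0 ?invr_ge0// ltW.
  have := ler_wpM2l Cc rk; have := e_down k; lra.
Qed.

Section Rates.
Variables (theta K0 K1 K2 : R).
Hypothesis K0_gt0 : 0 < K0.
Hypothesis K1_ge0 : 0 <= K1.
Hypothesis K2_ge0 : 0 <= K2.
Hypothesis theta_lt1 : theta < 1.
Hypothesis error_bound :
  \forall k \near \oo, 0 < r k.+1 -> r k.+1 `^ theta <= K0 * d k.
Hypothesis tail :
  \forall k \near \oo, e k <= K1 * r k `^ (1 / 2) + K2 * r k `^ (1 - theta).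

(** For theta = 0 the error bound reads 1 <= K0 d_k whenever r_{k+1} > 0, which
    is impossible once d_k < 1 / K0. *)
Lemma finite_rate : theta = 0 ->
  exists N : nat, forall k, (N <= k)%N -> e k = 0 /\ r k = 0.
Proof.
move=> th0; have iK : 0 < K0^-1 by rewrite invr_gt0.
have [N _ HN] := filterI (filterI error_bound tail) (step_lim iK).
exists N.+1 => -[//|k]; rewrite ltnS => Nk.
have r0 : r k.+1 = 0.
  have [[eb _] dk] := HN k Nk.
  have [r0|r0] := eqVneq (r k.+1) 0; first by [].
  have := eb; rewrite lt_neqAle eq_sym r0 r_ge0 => /(_ isT).
  rewrite th0 powRr0 => H; move: dk.
  by rewrite -(ltr_pM2l K0_gt0) divff ?gt_eqF// ltNge H.
split=> //; have [[_ t1] _] := HN k.+1 (leqW Nk).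
apply/eqP; rewrite eq_le e_ge0 andbT; apply: le_trans t1 _.
by rewrite r0 !powR0 ?mulr0 ?addr0// th0 ?subr0 ?oner_eq0// div1r invr_eq0 pnatr_eq0.
Qed.

Lemma value_recursion : \forall k \near \oo, 0 < r k.+1 ->
  r k.+1 `^ (2 * theta) <= K0 ^+ 2 / a * (r k - r k.+1).
Proof.
apply: filterS error_bound => k eb rp.
rewrite mulrC powRrM powR_mulrn ?powR_ge0//.
apply: (le_trans (y := K0 ^+ 2 * d k ^+ 2)).
  rewrite -exprMn ler_pXn2r ?nnegrE ?powR_ge0 ?eb//.
  by rewrite mulr_ge0 ?(ltW K0_gt0).
rewrite -mulrA ler_pM2l ?exprn_gt0// mulrC ler_pdivlMr// mulrC.
exact: descent.
Qed.

(** For theta <= 1/2 one has r <= r^(2 theta) once r <= 1. *)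
Lemma value_contraction : 0 < theta -> theta <= 1 / 2 ->
  exists q, [/\ 0 < q, q < 1 & \forall k \near \oo, r k.+1 <= q * r k].
Proof.
move=> th0 th2; pose K := K0 ^+ 2 / a.
have Kp : 0 < K by rewrite divr_gt0// exprn_gt0.
exists (K / (1 + K)); split; first by rewrite divr_gt0//; lra.
  by rewrite ltr_pdivrMr; lra.
have [N _ HN] := filterI value_recursion (r_lim ltr01); exists N => // k Nk.
have [rec _] := HN k Nk; have [_ r1] := HN k.+1 (leqW Nk).
rewrite mulrAC ler_pdivlMr; last lra.
have [->|r0] := eqVneq (r k.+1) 0; first by rewrite mul0r mulr_ge0 ?(ltW Kp).
have rp : 0 < r k.+1 by rewrite lt_neqAle eq_sym r0 r_ge0.
have : r k.+1 <= K * (r k - r k.+1).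
  apply: le_trans (rec rp); apply: ger1_powR; last lra.
  by rewrite rp ltW.
lra.
Qed.

Lemma linear_rate : 0 < theta -> theta <= 1 / 2 ->
  exists C q, [/\ 0 < C, 0 < q, q < 1 &
    forall k, e k <= C * q ^+ k /\ r k <= C * q ^+ k].
Proof.
move=> th0 th2; have [q [q0 q1 Hq]] := value_contraction th0 th2.
have [C C0 HC] := contraction_geometric q0 r_ge0 Hq.
(* The distances are controlled by the square root of the gaps, hence the
   ratio sqrt q; it serves for the gaps too since q <= sqrt q. *)
pose q' := Num.sqrt q; have q'0 : 0 < q' by rewrite sqrtr_gt0.
have q'1 : q' < 1 by rewrite -sqrtr1 ltr_sqrt.
have qq' : q <= q' by rewrite -{1}(sqr_sqrtr (ltW q0)) expr2 ler_piMr// ltW.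
have rC : \forall k \near \oo, r k <= C * q' ^+ k.
  apply: filterS HC => k H; apply: le_trans H _.
  by rewrite ler_wpM2l// lerXn2r ?nnegrE ?(ltW q0) ?(ltW q'0).
have eC : \forall k \near \oo, e k <= (K1 + K2) * Num.sqrt C * q' ^+ k.
  have [N _ HN] := filterI HC (filterI tail (r_lim ltr01)).
  exists N => // k Nk; have [rk [tk r1]] := HN k Nk.
  have sr : r k `^ (1 / 2) <= Num.sqrt C * q' ^+ k.
    have q'k : 0 <= q' ^+ k by rewrite exprn_ge0// ltW.
    rewrite div1r powR12_sqrt// -[q' ^+ k]ger0_norm// -sqrtr_sqr -sqrtrM//.
    by rewrite ler_wsqrtr// exprAC sqr_sqrtr ?(ltW q0).
  have sr2 : r k `^ (1 - theta) <= r k `^ (1 / 2).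
    have [->|r0] := eqVneq (r k) 0.
      by rewrite !powR0//; apply/eqP; lra.
    apply: ger_powR; last lra.
    by rewrite lt_neqAle eq_sym r0 r_ge0 ltW.
  apply: le_trans tk _; rewrite -mulrA mulrDl lerD// ler_wpM2l//.
  exact: le_trans sr2 sr.
have [C1 C10 H1] := geometric_extend C0 q'0 rC.
have [|C2 C20 H2] := geometric_extend _ q'0 eC.
  by rewrite mulr_ge0 ?sqrtr_ge0 ?addr_ge0.
exists (C1 + C2), q'; split=> //; first lra.
move=> k; have qk : 0 < q' ^+ k by rewrite exprn_gt0.
by split; [apply: le_trans (H2 k) _|apply: le_trans (H1 k) _];
  rewrite ler_wpM2r ?(ltW qk)//; lra.
Qed.

(** Apply [negative_power_increase] with p = 2 theta - 1; the increments start
    at the index N where the recursion becomes valid, and k - N >= k / 2 for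
    k > 2 N. *)
Lemma value_sublinear : 1 / 2 < theta ->
  exists2 A, 0 < A & \forall k \near \oo,
    r k <= A * k%:R `^ (- (1 / (2 * theta - 1))).
Proof.
move=> th2; pose p := 2 * theta - 1.
have p0 : 0 < p by rewrite /p; lra.
have p1 : p <= 1 by move: theta_lt1; rewrite /p; lra.
(* The summand 1 ensures K >= 1, as required to have t^p / K <= 1. *)
pose K := 1 + K0 ^+ 2 / a.
have K00 : 0 < K0 ^+ 2 / a by rewrite divr_gt0// exprn_gt0.
have Kp : 0 < K by rewrite /K; lra.
pose c := p / (4 * K); have c0 : 0 < c by rewrite divr_gt0// mulr_gt0.
have [N _ HN] := filterI value_recursion (r_lim ltr01).
have grow j : 0 < r (N + j)%N -> j%:R * c <= r (N + j)%N `^ (- p).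
  elim: j => [|j IH] rp; first by rewrite mul0r powR_ge0.
  have [rec _] := HN (N + j)%N (leq_addr _ _).
  have [_ r1] := HN (N + j).+1 (leqW (leq_addr _ _)).
  rewrite addnS in rp *.
  have rjp : 0 < r (N + j)%N by apply: lt_le_trans rp (value_decr _).
  have H := IH rjp; rewrite -natr1 mulrDl mul1r.
  have Kge1 : 1 <= K by rewrite /K; lra.
  have := @negative_power_increase _ p K (r (N + j)%N) _ p0 p1 Kge1 rp (ltW r1).
  rewrite -/c => H2; apply: (le_trans _ (H2 _)); first lra.
  have -> : 1 + p = 2 * theta by rewrite /p; lra.
  apply: le_trans (rec rp) _; rewrite ler_wpM2r ?subr_ge0 ?value_decr// /K.
  by lra.
have ip : 0 <= 1 / p by rewrite divr_ge0// ltW.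
exists ((c / 2) `^ (- (1 / p))); first by rewrite powR_gt0// divr_gt0.
exists (N + N).+1 => // k; rewrite /= => Nk; rewrite -/p.
have [->|r0] := eqVneq (r k) 0; first by rewrite mulr_ge0 ?powR_ge0.
have rp : 0 < r k by rewrite lt_neqAle eq_sym r0 r_ge0.
have c2 : 0 < c / 2 by rewrite divr_gt0.
rewrite -powRM ?ler0n ?(ltW c2)//.
have k0 : (0 < k)%N by apply: leq_ltn_trans Nk.
have kc : c / 2 * k%:R <= r k `^ (- p).
  have Nk' : (N <= k)%N by rewrite (leq_trans _ Nk)// leqW// leq_addr.
  have := grow (k - N)%N; rewrite subnKC// => /(_ rp); apply: le_trans.
  rewrite mulrAC ler_pdivrMr// [leRHS]mulrAC mulrC ler_pM2r//.
  rewrite -natrM ler_nat -{1}(subnK Nk') muln2 -addnn leq_add2l.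
  by rewrite leq_subRL// ltnW.
have := powR_neg_anti _ kc ip; rewrite mulr_gt0 ?ltr0n ?c2// => /(_ isT).
apply: le_trans; rewrite -powRrM mulrNN div1r mulfV ?gt_eqF// powRr1//.
Qed.

Lemma sublinear_rate : 1 / 2 < theta ->
  exists (delta1 delta2 : R) (N0 : nat), [/\ 0 < delta1, 0 < delta2, (0 < N0)%N &
    forall k, (N0 <= k)%N ->
      e k <= delta1 * k%:R `^ (- ((1 - theta) / (2 * theta - 1))) /\
      r k <= delta2 * k%:R `^ (- (1 / (2 * theta - 1)))].
Proof.
move=> th2; have [A A0 HA] := value_sublinear th2.
have th1 := theta_lt1.
have [N _ HN] := filterI HA (filterI tail (r_lim ltr01)).
have At : 0 < A `^ (1 - theta) by exact: powR_gt0.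
exists ((K1 + K2 + 1) * A `^ (1 - theta)), A, N.+1; split=> //.
  by rewrite mulr_gt0//; move: K1_ge0 K2_ge0; lra.
move=> k Nk; have [rk [tk r1]] := HN k (ltnW Nk); split=> //.
have sr : r k `^ (1 - theta) <= A `^ (1 - theta) * k%:R `^ (- ((1 - theta) / (2 * theta - 1))).
  have -> : - ((1 - theta) / (2 * theta - 1)) = - (1 / (2 * theta - 1)) * (1 - theta).
    by rewrite div1r mulNr mulrC.
  rewrite powRrM -powRM ?powR_ge0 ?(ltW A0)//.
  by apply: ge0_ler_powR; rewrite ?nnegrE ?mulr_ge0 ?powR_ge0 ?(ltW A0)//; lra.
have sr2 : r k `^ (1 / 2) <= r k `^ (1 - theta).
  have [->|r0] := eqVneq (r k) 0.
    by rewrite !powR0//; apply/eqP; lra.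
  apply: ger_powR; last lra.
  by rewrite lt_neqAle eq_sym r0 r_ge0 ltW.
have r0 : 0 <= r k `^ (1 - theta) by exact: powR_ge0.
apply: le_trans tk _; rewrite -mulrA.
apply: (le_trans (y := (K1 + K2 + 1) * r k `^ (1 - theta))); last first.
  by rewrite ler_wpM2l// ?addr_ge0.
have := ler_wpM2l K1_ge0 sr2; lra.
Qed.

End Rates.

Lemma power_KL_rates (C rho : R) (tau : \bar R) (c theta : R) :
  0 < C -> 0 < rho -> 0 < c -> 0 <= theta -> theta < 1 ->
  (forall eps, 0 < eps -> forall N, exists2 k, (N <= k)%N & e k < eps) ->
  (0 < tau)%E -> desingularizing tau (fun s => c * s `^ (1 - theta)) ->
  (forall k, e k < rho -> e k.+1 < rho -> 0 < r k.+1 -> ((r k.+1)%:E < tau)%E ->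
     1 <= derive1 (fun s => c * s `^ (1 - theta)) (r k.+1) * (C * d k)) ->
  KL_rates theta e r.
Proof.
move=> C0 rho0 c0 th0 th1 freq tau0 desing KL.
have [K0 [K1 [K2 [K00 K10 K20 eb tl]]]] :=
  power_KL_estimates C0 rho0 c0 th0 th1 freq tau0 desing KL.
split.
- exact: finite_rate K00 eb tl.
- exact: linear_rate K00 K10 K20 eb tl.
- exact: sublinear_rate K00 K10 K20 th1 eb tl.
Qed.

End DescentSequences.

(** * Limiting subgradients *)
Lemma limiting_subdiff_zero (R : realType) (n : nat) (s : 'rV[R]_n -> \bar R) u t0 :
  s u = t0%:E ->
  (forall e : R, 0 < e -> exists w v t, [/\ frechet_subdiff s w v,
     enorm (w - u) < e, enorm v < e, s w = t%:E & `|t - t0| < e]) ->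
  limiting_subdiff s u 0.
Proof.
move=> su H; split; first by rewrite su.
pose e (j : nat) : R := j.+1%:R^-1.
have e0 j : 0 < e j by rewrite invr_gt0.
have elim (d : R) : 0 < d -> exists N, forall j, (N <= j)%N -> e j < d.
  move=> d0; have [N _ HN] := near_infty_natSinv_lt (PosNum d0).
  by exists N => j Nj; exact: HN.
have /choice[w Hw] j : exists w, exists v t, [/\ frechet_subdiff s w v,
     enorm (w - u) < e j, enorm v < e j, s w = t%:E & `|t - t0| < e j].
  exact: H.
have /choice[y Hy] j : exists v, exists t, [/\ frechet_subdiff s (w j) v,
     enorm (w j - u) < e j, enorm v < e j, s (w j) = t%:E & `|t - t0| < e j].
  exact: Hw.
have /choice[t Ht] j : exists t, [/\ frechet_subdiff s (w j) (y j),
     enorm (w j - u) < e j, enorm (y j) < e j, s (w j) = t%:E & `|t - t0| < e j].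
  exact: Hy.
exists w, y; split.
- apply: cvg_enormP => d d0; have [N HN] := elim _ d0; exists N => k Nk.
  by have [_ A _ _ _] := Ht k; apply: lt_trans A (HN k Nk).
- have E : (fun k => s (w k)) = (fun k => (t k)%:E).
    by apply/funext => j /=; have [] := Ht j.
  rewrite E su; apply: cvg_EFin; first by near=> j.
  apply/cvgrPdist_lt => d d0; have [N HN] := elim _ d0; exists N => // k Nk /=.
  by have [_ _ _ _ A] := Ht k; rewrite distrC; apply: lt_trans A (HN k Nk).
- by move=> k; have [] := Ht k.
- apply: cvg_enormP => d d0; have [N HN] := elim _ d0; exists N => k Nk.
  by have [_ _ A _ _] := Ht k; rewrite subr0; apply: lt_trans A (HN k Nk).
Unshelve. all: by end_near. Qed.

Lemma frechet_limiting (R : realType) (n : nat) (s : 'rV[R]_n -> \bar R) u v :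
  frechet_subdiff s u v -> limiting_subdiff s u v.
Proof.
move=> Hv; split; first by case: Hv.
by exists (fun=> u), (fun=> v); split=> //; exact: cvg_cst.
Qed.

Lemma dist0_le (R : realType) (n : nat) (A : set 'rV[R]_n) v :
  A v -> (dist0 A <= (enorm v)%:E)%E.
Proof. by move=> Av; apply: ereal_inf_lbound; exists v. Qed.

(** * The objective and its variational inequality *)
Section DCA.
Variables (R : realType) (m : nat) (n_ : 'I_m -> nat).
Variables (X : set 'rV[R]_(\sum_i n_ i)) (f : 'rV[R]_(\sum_i n_ i) -> R) (L : R).
Variables (g : forall i, 'rV[R]_(n_ i) -> R).
Variables (D : 'I_m -> set R) (h : 'I_m -> R -> R).

Arguments g : clear implicits.

Local Notation V := 'rV[R]_(\sum_i n_ i).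
Local Notation G i x := (g i (submxrow x i)).
Local Notation dh i := (derive1 (h i)).
Local Notation lift := (lift_pt g).
Local Notation F := (fun x : V => f x + \sum_i h i (G i x)).

Hypothesis X_convex : convex_set X.
Hypothesis f_diff : forall u, differentiable f u.
Hypothesis f_lip : forall u v,
  enorm (gradient f u - gradient f v) <= L * enorm (u - v).
Hypothesis g_cont : forall i, continuous (g i).
Hypothesis g_convex : forall i, convex_function setT (g i).
Hypothesis D_open : forall i, open (D i).
Hypothesis D_g : forall i u, X u -> D i (G i u).
Hypothesis h_concave : forall i, convex_function (D i) (fun t => - h i t).
Hypothesis h_derivable : forall i t, D i t -> derivable (h i) t 1.

Arguments g_convex : clear implicits.
Arguments h_concave : clear implicits.

Hypothesis h_subdiff : forall i u t, X u -> G i u <= t ->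
  subdiff ( *%R ) (neg_ext h D i) t `<=` [set y | y <= 0].

(** -h_i'(t) is a subgradient of -h_i at t = g_i(u), hence nonpositive. *)
Lemma derive_h_ge0 i u : X u -> 0 <= dh i (G i u).
Proof.
move=> Xu; rewrite -oppr_le0; apply: (h_subdiff Xu (lexx (G i u))).
have Du := D_g i Xu; split; first by rewrite /neg_ext mem_set.
move=> w; rewrite /neg_ext mem_set//; case: ifPn => [|_]; last exact: leey.
rewrite inE => Dw; rewrite -EFinD lee_fin.
by have := concave_tangent (h_concave i) Du Dw (h_derivable Du); lra.
Qed.

Lemma lsubmx_lift x : lsubmx (lift x) = x. Proof. exact: row_mxKl. Qed.
Lemma rsubmx_lift x i : rsubmx (lift x) 0 i = G i x.
Proof. by rewrite row_mxKr mxE. Qed.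

Lemma phi_Omega w : Omega X g w ->
  phi X f g h w = (f (lsubmx w) + \sum_i h i (rsubmx w 0 i))%:E.
Proof. by move=> Ow; rewrite /phi /chi mem_set// add0e -EFinD. Qed.

Lemma phi_notOmega w : ~ Omega X g w -> phi X f g h w = +oo%E.
Proof. by move=> Ow; rewrite /phi /chi memNset. Qed.

Lemma Omega_lift x : X x -> Omega X g (lift x).
Proof. by move=> Xx; split; rewrite lsubmx_lift// => i; rewrite rsubmx_lift. Qed.

Lemma phi_lift x : X x -> phi X f g h (lift x) = (F x)%:E.
Proof.
move=> Xx; rewrite phi_Omega; last exact: Omega_lift.
by rewrite lsubmx_lift; congr (_ + _)%:E; apply: eq_bigr => i _; rewrite rsubmx_lift.
Qed.

Lemma Hfun_lift mu x : X x ->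
  Hfun f h D mu (lift x) = (mu / 2 * enorm x ^+ 2 - F x)%:E.
Proof.
move=> Xx; rewrite /Hfun lsubmx_lift.
rewrite (eq_bigr (fun i => (- h i (G i x))%:E)); last first.
  by move=> i _; rewrite rsubmx_lift /neg_ext mem_set//; exact: D_g.
by rewrite sumEFin -EFinD sumrN opprD addrA.
Qed.

Lemma block_continuous i : continuous (fun x : V => G i x).
Proof.
move=> x; apply: (@continuous_comp _ _ _ (fun x : V => submxrow x i) (g i));
  last exact: g_cont.
have Fx : Filter (nbhs x) by exact: nbhs_filter.
apply/(@cvgrPdist_lt _ _ _ (nbhs x) Fx) => e e0; have := @nbhsx_ballx _ _ x _ e0.
apply: filterS => y; rewrite -ball_normE /=; apply: le_lt_trans.
rewrite [leLHS]/Num.norm /= mx_normrE; apply/bigmax_leP; split=> [|[j k] _ /=].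
  exact: normr_ge0.
by rewrite ord1 !mxE; have := coord_le_norm (x - y) (tagnat.Rank i k); rewrite !mxE.
Qed.

Lemma block_convex i (l : R) (x y : V) : 0 <= l -> l <= 1 ->
  G i (l *: x + (1 - l) *: y) <= l * G i x + (1 - l) * G i y.
Proof.
move=> l0 l1.
have -> : submxrow (l *: x + (1 - l) *: y) i =
    l *: submxrow x i + (1 - l) *: submxrow y i.
  by apply/matrixP => j k; rewrite !mxE.
exact: (convex_functionP (g_convex i) l0 l1 I I).
Qed.

Lemma block_convex_function i : convex_function setT (fun x : V => G i x).
Proof. by move=> t x y _ _; apply: block_convex. Qed.

(** Compare y with the points l x + (1 - l) y of X: since the weights -xi_i are
    nonnegative the nonsmooth part is convex, and the terms of first order in l
    must be nonnegative. *)
Lemma model_variational (mu : R) (xk y : V) (xi : 'rV[R]_m) :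
  (forall i, xi 0 i <= 0) -> is_argmin X (model f g mu xk xi) y ->
  forall x, X x -> 0 <= dotv (mu *: (y - xk) + gradient f xk) (x - y)
    + \sum_i (- xi 0 i) * (G i x - G i y).
Proof.
move=> xi0 [Xy ymin] x Xx; apply: (@small_param_ge0 _ _ (mu / 2 * enorm (x - y) ^+ 2)).
move=> l l0 l1; have := ymin _ (convex_setP X_convex (ltW l0) l1 Xx Xy).
rewrite /model; set z := l *: x + _.
have zy : z - xk = (y - xk) + l *: (x - y).
  by apply/rowP => i; rewrite !mxE; ring.
have zg : dotv (gradient f xk) z = dotv (gradient f xk) y + l * dotv (gradient f xk) (x - y).
  by rewrite -dotvZr -dotvDr; congr dotv; apply/rowP => i; rewrite !mxE; ring.
have sg : \sum_i (- xi 0 i) * G i z <= \sum_i (- xi 0 i) * G i y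
     + l * \sum_i (- xi 0 i) * (G i x - G i y).
  rewrite mulr_sumr -big_split; apply: ler_sum => i _ /=.
  have : 0 <= - xi 0 i by rewrite oppr_ge0.
  by move=> /ler_wpM2l/(_ _ _ (block_convex i x y (ltW l0) l1)); lra.
rewrite zy zg (enorm_sqrD (y - xk)) dotvZr enormZ exprMn (ger0_norm (ltW l0)).
rewrite (dotvDl (mu *: _)) (dotvZl mu); lra.
Qed.

(** For mu >= L the function H_mu is convex, and the acceptance test is its
    subgradient inequality at xk. *)
Lemma rejected_lt_L (mu : R) (xk y : V) (xi : 'rV[R]_m) : X xk -> X y ->
  (forall i, xi 0 i = - dh i (G i xk)) ->
  rejected f g h D xk xi mu y -> mu < L.
Proof.
move=> Xk Xy xiE; rewrite /rejected !Hfun_lift// -EFinD lte_fin => H.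
rewrite ltNge; apply/negP => Lmu; move: H; apply/negP; rewrite -leNgt.
have hs : \sum_i h i (G i y) <= \sum_i h i (G i xk) - dotv xi (gvec g y - gvec g xk).
  rewrite -sumrN -big_split; apply: ler_sum => i _ /=.
  rewrite !mxE xiE mulNr opprK.
  have Dk := D_g i Xk.
  exact: (concave_tangent (h_concave i) Dk (D_g i Xy) (h_derivable Dk)).
have := descent_lemma f_diff f_lip xk y.
have := enorm_sqrD xk (y - xk); rewrite subrKC => ->.
rewrite dotvBl dotvZl.
have : 0 <= (mu - L) * enorm (y - xk) ^+ 2.
  by rewrite mulr_ge0 ?sqr_ge0// subr_ge0.
lra.
Qed.

Lemma linesearch_exit (eta mu0 mu : R) (xk y : V) (xi : 'rV[R]_m) : X xk ->
  1 < eta -> 0 < mu0 ->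
  (forall i, xi 0 i = - dh i (G i xk)) ->
  linesearch X f g h D eta xk xi mu0 mu y ->
  [/\ is_argmin X (model f g mu xk xi) y, ~ rejected f g h D xk xi mu y,
      mu0 <= mu & mu <= Num.max mu0 (eta * L)].
Proof.
move=> Xk eta1 + xiE ls; elim: ls => {mu0 mu y}.
  by move=> mu y ymin nrej mu0; split=> //; rewrite le_max lexx.
move=> mu mu' y y' ymin rej _ IH mu0.
have eta0 : 0 < eta by lra.
have [|mm nr le1 le2] := IH; first by rewrite mulr_gt0.
have muL := rejected_lt_L Xk ymin.1 xiE rej; split=> //.
  by apply: le_trans le1; rewrite ler_peMl// ltW.
apply: le_trans le2 _; rewrite ge_max !le_max lexx orbT andbT.
by rewrite ler_pM2l// (ltW muL) orbT.
Qed.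

(** Testing the variational inequality at xk gives
    <grad f(xk), y - xk> - <xi, g(y) - g(xk)> <= - mu |y - xk|^2, while the
    acceptance test says that F(y) - F(xk) exceeds the left-hand side by at
    most (mu / 2) |y - xk|^2. *)
Lemma accepted_descent (mu : R) (xk y : V) (xi : 'rV[R]_m) : X xk ->
  (forall i, xi 0 i <= 0) ->
  is_argmin X (model f g mu xk xi) y -> ~ rejected f g h D xk xi mu y ->
  mu / 2 * enorm (y - xk) ^+ 2 <= F xk - F y.
Proof.
move=> Xk xi0 ymin; have Xy := ymin.1.
have := model_variational xi0 ymin Xk.
rewrite /rejected !Hfun_lift// -EFinD lte_fin => VI /negP; rewrite -leNgt.
have := enorm_sqrD xk (y - xk); rewrite subrKC => ->.
have : \sum_i (- xi 0 i) * (G i xk - G i y) = dotv xi (gvec g y - gvec g xk).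
  by apply: eq_bigr => i _; rewrite !mxE; ring.
move: VI; rewrite -(opprB y xk) !dotvNr dotvDl dotvZl -(enorm_sqr (y - xk)) dotvBl dotvZl; lra.
Qed.

Lemma rsubmx_dist (w : 'rV[R]_(\sum_i n_ i + m)) y i :
  `|rsubmx w 0 i - G i y| <= enorm (w - lift y).
Proof.
have := coord_le_enorm (w - lift y) (rshift _ i); congr (`|_| <= _).
by rewrite -(rsubmx_lift y i) !mxE.
Qed.

Lemma lsubmx_dist (w : 'rV[R]_(\sum_i n_ i + m)) y :
  enorm (lsubmx w - y) <= enorm (w - lift y).
Proof.
apply: le_trans (enorm_lsubmx _); rewrite -{1}(lsubmx_lift y).
by rewrite -linearB.
Qed.

Lemma dotv_lift (a : V) (b : 'rV[R]_m) w y :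
  dotv (row_mx a b) (w - lift y) =
  dotv a (lsubmx w - y) + \sum_i b 0 i * (rsubmx w 0 i - G i y).
Proof.
rewrite dotv_split; congr (_ + _).
  by congr dotv; rewrite -{2}(lsubmx_lift y) -linearB.
by apply: eq_bigr => i _; rewrite -(rsubmx_lift y i) !mxE.
Qed.

(** Equivalently, (-a, -b) is normal to Omega at (y, g(y)) when b >= 0.  The
    choice a = grad f(y), b_i = h_i'(g_i(y)) expresses criticality, and the
    minimality of an iterate for the model gives the inequality for a
    perturbation of this choice. *)
Definition variational_ineq (a : V) (b : 'I_m -> R) (y : V) := forall x, X x ->
  0 <= dotv a (x - y) + \sum_i b i * (G i x - G i y).

(** The subgradient of phi at (y, g(y)) obtained by adding the normal (-a, -b) to
    the gradient of f + sum_i h_i. *)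
Definition residual (a : V) (b : 'I_m -> R) (y : V) :=
  row_mx (gradient f y - a) (\row_i (dh i (G i y) - b i)).

(** On Omega one has z_i >= g_i(x), so b >= 0 carries the variational inequality
    over to (x, z); f and the h_i contribute their first-order expansions, with
    errors that are small compared with the distance to (y, g(y)). *)
Lemma residual_frechet a b y : X y -> (forall i, 0 <= b i) ->
  variational_ineq a b y -> frechet_subdiff (phi X f g h) (lift y) (residual a b y).
Proof.
move=> Xy b0 VI; split; first by rewrite phi_lift.
move=> e e0; have m0 : 0 < m%:R + 1 :> R by rewrite ltr_wpDl.
(* One share e' of the error for f and one for each h_i. *)
pose e' := e / (m%:R + 1); have e'0 : 0 < e' by rewrite divr_gt0.
have N1 : \forall w \near lift y, `|L| * 3 / 2 * enorm (w - lift y) <= e'.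
  have d0 : 0 < e' / (`|L| * 3 / 2 + 1) by rewrite divr_gt0// ltr_wpDl// !mulr_ge0.
  have := near_enorm (lift y) d0; apply: filterS => w.
  rewrite ltr_pdivlMr ?ltr_wpDl ?mulr_ge0//.
  by have := enorm_ge0 (w - lift y); lra.
have N2 : \forall w \near lift y, forall i,
    `|h i (rsubmx w 0 i) - h i (G i y) - dh i (G i y) * (rsubmx w 0 i - G i y)|
      <= e' * `|rsubmx w 0 i - G i y|.
  apply: near_forall_fin => i.
  have /nbhs_ballP[d /= d0 Hd] := derivable_expansion (h_derivable (D_g i Xy)) e'0.
  have := near_enorm (lift y) d0; apply: filterS => w H; apply: Hd.
  by rewrite /ball /= distrC; apply: le_lt_trans H; exact: rsubmx_dist.
have FF : Filter (nbhs (lift y)) by exact: nbhs_filter.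
apply: filterS (filterI N1 N2) => w [W1 W2].
rewrite phi_lift// -EFinD.
have [Ow|nOw] := pselect (Omega X g w); last by rewrite phi_notOmega// leey.
rewrite phi_Omega// lee_fin /residual dotv_lift dotvBl.
have [Xw zw] := Ow; have := VI _ Xw.
set x := lsubmx w in Xw zw *; set d := enorm (w - lift y) in W1 *.
have d0 : 0 <= d by exact: enorm_ge0.
have fx : f y + dotv (gradient f y) (x - y) - e' * d <= f x.
  have := descent_lemma_lower f_diff f_lip y x; apply: le_trans.
  rewrite lerD2l lerN2; apply: (le_trans (y := `|L| * 3 / 2 * d ^+ 2)).
    have s2 : enorm (x - y) ^+ 2 <= d ^+ 2.
      by rewrite ler_pXn2r ?nnegrE ?enorm_ge0//; exact: lsubmx_dist.
    have := ler_wpM2r (sqr_ge0 (enorm (x - y))) (ler_norm L).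
    by have := ler_wpM2l (normr_ge0 L) s2; lra.
  by rewrite expr2 mulrA ler_wpM2r.
have hz : \sum_i (h i (G i y) + dh i (G i y) * (rsubmx w 0 i - G i y)) - m%:R * (e' * d)
    <= \sum_i h i (rsubmx w 0 i).
  rewrite mulr_natl -[X in _ *+ X]card_ord -sumr_const -sumrB.
  apply: ler_sum => i _; have := W2 i; rewrite ler_norml => /andP[A _].
  by have := ler_wpM2l (ltW e'0) (rsubmx_dist w y i); rewrite -/d; lra.
have bz : \sum_i b i * (G i x - G i y) <= \sum_i b i * (rsubmx w 0 i - G i y).
  by apply: ler_sum => i _; rewrite ler_wpM2l// lerD2r.
have -> : \sum_i (\row_i0 (dh i0 (G i0 y) - b i0)) 0 i * (rsubmx w 0 i - G i y) =
   \sum_i dh i (G i y) * (rsubmx w 0 i - G i y) - \sum_i b i * (rsubmx w 0 i - G i y).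
  by rewrite -sumrB; apply: eq_bigr => i _; rewrite !mxE mulrBl.
rewrite big_split /= in hz.
have ed : e * d = e' * d + m%:R * (e' * d).
  by rewrite /e'; field; rewrite gt_eqF.
by rewrite ed; lra.
Qed.

Lemma near_lift p e : 0 < e -> \forall u \near p, enorm (lift u - lift p) < e.
Proof.
move=> e0; have m0 : 0 < m%:R + 1 :> R by rewrite ltr_wpDl.
have e2 : 0 < e / 2 by rewrite divr_gt0.
have N1 := near_enorm p e2.
have N2 : \forall u \near p, forall i, `|G i u - G i p| <= e / 2 / (m%:R + 1).
  apply: near_forall_fin => i.
  have := (@cvgrPdist_le _ _ _ (nbhs p) (nbhs_filter p) _ _).1
    (@block_continuous i p) _ (divr_gt0 e2 m0).
  by apply: filterS => u; rewrite distrC.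
have FF : Filter (nbhs p) by exact: nbhs_filter.
apply: filterS (filterI N1 N2) => u [A B].
have -> : lift u - lift p = row_mx (u - p) (gvec g u - gvec g p).
  by rewrite /lift_pt opp_row_mx add_row_mx.
apply: le_lt_trans (enorm_row_mx _ _) _; rewrite (splitr e); apply: ltr_leD => //.
apply: le_trans (enorm_le_sum _) _.
apply: (le_trans (y := \sum_(i < m) e / 2 / (m%:R + 1))).
  by apply: ler_sum => i _; have := B i; rewrite !mxE.
rewrite sumr_const card_ord -[leLHS]mulr_natl mulrCA ler_piMr ?(ltW e2)//.
by rewrite ler_pdivrMr// mul1r lerDl.
Qed.

Hypothesis h_loclip : forall i t, D i t ->
  exists2 U, nbhs t U & [lipschitz derive1 (h i) s | s in U].

Lemma derive_h_locally_lipschitz p : X p ->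
  exists K rho : R, [/\ 0 <= K, 0 < rho & forall u v,
    enorm (u - p) < rho -> enorm (v - p) < rho ->
    \sum_i `|dh i (G i u) - dh i (G i v)| <= K * enorm (u - v)].
Proof.
move=> Xp.
have H i : exists K : R, exists U, [/\ 0 <= K, nbhs p U & forall u v, U u -> U v ->
    `|dh i (G i u) - dh i (G i v)| <= K * enorm (u - v)].
  have [W nW [M [_ HM]]] := h_loclip (D_g i Xp).
  have [K [rho [K0 rho0 HK]]] :=
    convex_locally_lipschitz (@block_continuous i p) (@block_convex_function i).
  have M0 : 0 <= `|M| + 1 by rewrite addr_ge0.
  exists ((`|M| + 1) * K), [set u | enorm (u - p) < rho /\ W (G i u)]; split.
  - by rewrite mulr_ge0.
  - by apply: filterI; [exact: near_enorm | exact: (@block_continuous i p)].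
  move=> u v [u1 u2] [v1 v2].
  have := HM (`|M| + 1); rewrite (le_lt_trans (ler_norm M)) ?ltrDl// => /(_ isT).
  move=> /(_ (G i u, G i v) (conj u2 v2)) /= A; apply: le_trans A _.
  by rewrite -mulrA ler_wpM2l// HK.
have [K HK] := choice H; have [U HU] := choice HK.
have [rho rho0 Hrho] : exists2 rho, 0 < rho & forall u, enorm (u - p) < rho ->
    forall i, U i u.
  by apply: nbhs_enormP; apply: near_forall_fin => i; have [] := HU i.
exists (\sum_i K i), rho; split=> //.
  by apply: sumr_ge0 => i _; have [] := HU i.
move=> u v up vp; rewrite mulr_suml; apply: ler_sum => i _.
by have [_ _ A] := HU i; apply: A; apply: Hrho.
Qed.

Lemma objective_continuous p : X p -> {for p, continuous F}.
Proof.
move=> Xp; have fc := differentiable_continuous (f_diff p).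
apply: (@cvgD _ _ _ (nbhs p) _ f _ _ _ fc).
apply: cvg_big => [|i _]; first exact: add_continuous.
apply: (@cvg_comp _ _ _ (fun x : V => G i x) (h i)); first exact: block_continuous.
exact: (differentiable_continuous ((derivable1_diffP _ _).1 (h_derivable (D_g i Xp)))).
Qed.

(** Psi y is the variational expression at y for the unperturbed choice
    a = grad f(y), b_i = h_i'(g_i(y)); it differs from the perturbed one by the
    pairing of the residual with (u, g(u)) - (y, g(y)), and it is continuous
    at p. *)
Lemma stationary_of_approach p : X p -> continuous (gradient f) ->
  (forall e : R, 0 < e -> exists y a b, [/\ variational_ineq a b y,
     enorm (y - p) < e & enorm (residual a b y) < e]) ->
  variational_ineq (gradient f p) (fun i => dh i (G i p)) p.
Proof.
move=> Xp fC1 appr u Xu.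
pose Psi y := dotv (gradient f y) (u - y) + \sum_i dh i (G i y) * (G i u - G i y).
have FF : Filter (nbhs p) by exact: nbhs_filter.
have Psic : Psi y @[y --> p] --> Psi p.
  apply: cvgD; apply: cvg_big => [|i _]; first 1 last.
  - apply: cvgM.
      apply: (@cvg_comp _ _ _ (gradient f) (fun v : V => v 0 i)); first exact: fC1.
      exact: coord_continuous.
    under eq_cvg do rewrite !mxE.
    rewrite !mxE; apply: cvgB; first exact: cvg_cst.
    exact: coord_continuous.
  - exact: add_continuous.
  - apply: cvgM; last by apply: cvgB; [exact: cvg_cst|exact: block_continuous].
    have [K [rho [K0 rho0 HK]]] := derive_h_locally_lipschitz Xp.
    apply/cvgrPdist_lt => e e0.
    have d0 : 0 < Num.min rho (e / (K + 1)).
      by rewrite lt_min rho0 divr_gt0// ltr_wpDl.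
    have := near_enorm p d0; apply: filterS => y; rewrite lt_min => /andP[y1 y2].
    have := HK p y; rewrite subrr enorm0 => /(_ rho0 y1); rewrite (bigD1 i)//=.
    have : 0 <= \sum_(i0 < m | i0 != i) `|dh i0 (G i0 p) - dh i0 (G i0 y)|.
      by apply: sumr_ge0.
    move: y2; rewrite ltr_pdivlMr ?ltr_wpDl// (enormBC p y).
    by have := enorm_ge0 (y - p); lra.
  - exact: add_continuous.
rewrite -/(Psi p); apply/ler_addgt0Pr => e e0.
have e2 : 0 < e / 2 by rewrite divr_gt0.
pose B := enorm (lift u - lift p) + 1; have B0 : 0 < B by rewrite ltr_wpDl ?enorm_ge0.
have [d d0 Hd] : exists2 d, 0 < d & forall y, enorm (y - p) < d ->
    `|Psi p - Psi y| < e / 2 /\ enorm (lift y - lift p) < 1.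
  apply: nbhs_enormP; apply: filterI; last exact: near_lift.
  exact: ((cvgrPdist_lt _ _).1 Psic).
have m0 : 0 < Num.min d (e / 2 / B) by rewrite lt_min d0 divr_gt0.
have [y [a [b [VI yp vy]]]] := appr _ m0.
move: yp vy; rewrite !lt_min => /andP[yd _] /andP[_ vy].
have [Py ly] := Hd y yd; have := VI u Xu.
have -> : dotv a (u - y) + \sum_i b i * (G i u - G i y) =
    Psi y - dotv (residual a b y) (lift u - lift y).
  rewrite dotv_lift lsubmx_lift dotvBl /Psi.
  have -> : \sum_i (\row_i0 (dh i0 (G i0 y) - b i0)) 0 i * (rsubmx (lift u) 0 i - G i y) =
     \sum_i dh i (G i y) * (G i u - G i y) - \sum_i b i * (G i u - G i y).
    by rewrite -sumrB; apply: eq_bigr => i _; rewrite rsubmx_lift mxE mulrBl.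
  by ring.
have uy : enorm (lift u - lift y) <= B.
  have := ler_enormB_trans (lift u) (lift p) (lift y).
  by rewrite (enormBC (lift p)) /B; lra.
have : - dotv (residual a b y) (lift u - lift y) <= e / 2.
  have := dotv_abs (residual a b y) (lift u - lift y); rewrite ler_norml => /andP[A _].
  have : enorm (residual a b y) * enorm (lift u - lift y) <= e / 2; last lra.
  apply: (le_trans (y := e / 2 / B * B)); last by rewrite divfK ?gt_eqF.
  by apply: ler_pM; rewrite ?enorm_ge0// ltW.
by move: Py; rewrite ltr_norml => /andP[]; lra.
Qed.

(** The common element is (mu p - grad f(p), -h'(g(p))).  It belongs to the
    subdifferential of H_mu by the descent lemma (as L <= mu) and the concavity
    of the h_i, and to that of G_mu by the variational inequality. *)
Lemma stationary_critical p : X p ->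
  variational_ineq (gradient f p) (fun i => dh i (G i p)) p ->
  critical_point X f g h D L (lift p).
Proof.
move=> Xp VI mu mu0 Lmu.
exists (row_mx (mu *: p - gradient f p) (\row_i (- dh i (G i p)))); split; split.
- by rewrite Hfun_lift.
- move=> w; rewrite Hfun_lift// dotv_lift -EFinD /Hfun.
  pose T i := - h i (G i p) - dh i (G i p) * (rsubmx w 0 i - G i p).
  apply: (@le_trans _ _ ((mu / 2 * enorm (lsubmx w) ^+ 2 - f (lsubmx w))%:E
      + \sum_i (T i)%:E)%E).
    rewrite sumEFin -EFinD lee_fin.
    have -> : \sum_i (\row_i0 - dh i0 (G i0 p)) 0 i * (rsubmx w 0 i - G i p) =
       \sum_i T i + \sum_i h i (G i p).
      by rewrite -big_split; apply: eq_bigr => i _ /=; rewrite mxE /T; ring.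
    set x := lsubmx w; have := descent_lemma f_diff f_lip p x.
    have := enorm_sqrD p (x - p); rewrite subrKC => ->.
    rewrite dotvBl dotvZl.
    have : 0 <= (mu - L) * enorm (x - p) ^+ 2 by rewrite mulr_ge0 ?sqr_ge0// subr_ge0.
    lra.
  apply: leeD2l; apply: lee_sum => i _; rewrite /neg_ext.
  case: ifPn => [|_]; last exact: leey.
  rewrite inE => Dw; rewrite lee_fin /T.
  have := concave_tangent (h_concave i) (D_g i Xp) Dw (h_derivable (D_g i Xp)).
  lra.
- by rewrite /Gfun /chi mem_set//; exact: Omega_lift.
- move=> w; rewrite /Gfun /chi mem_set; last exact: Omega_lift.
  case: ifPn => [|_]; last by rewrite addey// leey.
  rewrite inE => -[Xw zw]; rewrite !adde0 -EFinD lee_fin dotv_lift lsubmx_lift.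
  set x := lsubmx w in Xw zw *; have := VI x Xw.
  have := enorm_sqrD p (x - p); rewrite subrKC => ->.
  have -> : \sum_i (\row_i0 - dh i0 (G i0 p)) 0 i * (rsubmx w 0 i - G i p) =
     - \sum_i dh i (G i p) * (rsubmx w 0 i - G i p).
    by rewrite -sumrN; apply: eq_bigr => i _; rewrite !mxE mulNr.
  have : \sum_i dh i (G i p) * (G i x - G i p) <=
      \sum_i dh i (G i p) * (rsubmx w 0 i - G i p).
    apply: ler_sum => i _; rewrite ler_wpM2l ?lerD2r//.
    exact: derive_h_ge0.
  rewrite dotvBl dotvZl.
  have := mulr_ge0 (ltW mu0) (sqr_ge0 (enorm (x - p))); lra.
Qed.

(** * One step of the algorithm *)
Variables (eta delta mu_low : R).
Variables (x : nat -> V) (xi : nat -> 'rV[R]_m) (mu : nat -> R).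
Hypothesis X_closed : closed X.
Hypothesis f_C1 : continuous (gradient f).
Hypothesis eta_gt1 : 1 < eta.
Hypothesis delta_lt1 : delta < 1.
Hypothesis mu_low_gt0 : 0 < mu_low.
Hypothesis x_gen : DCA_like X f g h D eta delta mu_low x xi mu.
Hypothesis x_bounded : bounded_set (range x).

Local Notation mu_max := (Num.max mu_low (eta * L)).
Local Notation d k := (enorm (x k.+1 - x k)).

Lemma iterate_exit k : X (x k) ->
  let mu0 := if k is k'.+1 then Num.max mu_low (delta * mu k') else mu_low in
  0 < mu0 ->
  [/\ forall i, xi k 0 i = - dh i (G i (x k)),
      is_argmin X (model f g (mu k) (x k) (xi k)) (x k.+1),
      ~ rejected f g h D (x k) (xi k) (mu k) (x k.+1),
      mu0 <= mu k & mu k <= Num.max mu0 (eta * L)].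
Proof.
move=> Xk mu0 mu00; have [_ /(_ k)[sd ls]] := x_gen.
have xiE i : xi k 0 i = - dh i (G i (x k)).
  by apply: subdiff_neg_ext (sd i); [exact: D_open|exact: D_g|exact/h_derivable/D_g].
by have [] := linesearch_exit Xk eta_gt1 mu00 xiE ls.
Qed.

(** The parameter on entry is at most mu_max by induction, since delta < 1, and
    the line search never leaves [mu_low, mu_max]. *)
Lemma iterate_facts k : [/\ X (x k), X (x k.+1), mu_low <= mu k & mu k <= mu_max].
Proof.
elim: k => [|k [Xk Xk1 mu1 mu2]].
  have X0 : X (x 0%N) by have [] := x_gen.
  by have [_ [X1 _] _ A B] := iterate_exit X0 mu_low_gt0.
have m0 : 0 < Num.max mu_low (delta * mu k) by rewrite lt_max mu_low_gt0.
have [_ [X2 _] _ A B] := iterate_exit (k := k.+1) Xk1 m0; split=> //.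
  by apply: le_trans A; rewrite le_max lexx.
apply: le_trans B _; rewrite !ge_max !le_max !lexx orbT !andbT /=.
have : delta * mu k <= mu_max.
  apply: le_trans mu2; rewrite ler_piMl ?ltW//.
  by apply: lt_le_trans mu1.
by rewrite le_max.
Qed.

Lemma iterate_in k : X (x k). Proof. by have [] := iterate_facts k. Qed.

Lemma iterate_step k :
  [/\ forall i, xi k 0 i = - dh i (G i (x k)),
      is_argmin X (model f g (mu k) (x k) (xi k)) (x k.+1) &
      ~ rejected f g h D (x k) (xi k) (mu k) (x k.+1)].
Proof.
have m0 : 0 < if k is k'.+1 then Num.max mu_low (delta * mu k') else mu_low.
  by case: k => [|k]//; rewrite lt_max mu_low_gt0.
by have [] := iterate_exit (iterate_in k) m0.
Qed.

Lemma xi_le0 k i : xi k 0 i <= 0.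
Proof.
by have [-> _ _] := iterate_step k; rewrite oppr_le0; exact: derive_h_ge0 (iterate_in k).
Qed.

Lemma iterate_descent k : mu_low / 2 * d k ^+ 2 <= F (x k) - F (x k.+1).
Proof.
have [_ am nr] := iterate_step k; have [_ _ mul _] := iterate_facts k.
apply: le_trans (accepted_descent (iterate_in k) (xi_le0 k) am nr).
by rewrite ler_wpM2r ?sqr_ge0// ler_pM2r.
Qed.

Local Notation a_ k := (mu k *: (x k.+1 - x k) + gradient f (x k)).
Local Notation b_ k := (fun i => dh i (G i (x k))).

Lemma iterate_variational_ineq k : variational_ineq (a_ k) (b_ k) (x k.+1).
Proof.
move=> u Xu; have [xiE am _] := iterate_step k.
have := model_variational (xi_le0 k) am Xu; congr (_ <= _ + _).
by apply: eq_bigr => i _; rewrite xiE opprK.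
Qed.

(** Only a local bound is claimed, near a point of X; it suffices because the KL
    inequality is local as well. *)
Lemma residual_bound p : X p -> exists C rho : R, [/\ 0 < C, 0 < rho &
  forall k, enorm (x k - p) < rho -> enorm (x k.+1 - p) < rho ->
    enorm (residual (a_ k) (b_ k) (x k.+1)) <= C * d k].
Proof.
move=> Xp; have [K [rho [K0 rho0 HK]]] := derive_h_locally_lipschitz Xp.
exists (mu_max + `|L| + K), rho; split=> //.
  have : 0 < mu_max by rewrite lt_max mu_low_gt0.
  by have := normr_ge0 L; lra.
move=> k ek ek1; apply: le_trans (enorm_row_mx _ _) _.
rewrite mulrDl; apply: lerD; last first.
  apply: le_trans (enorm_le_sum _) _; apply: le_trans (HK _ _ ek1 ek).
  by under eq_bigr do rewrite mxE.
rewrite opprD addrA addrAC; apply: le_trans (ler_enormD _ _) _.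
have [_ _ mul muu] := iterate_facts k.
rewrite mulrDl [leRHS]addrC; apply: lerD; last first.
  rewrite enormN enormZ ger0_norm ?(le_trans (ltW mu_low_gt0) mul)//.
  by rewrite ler_wpM2r ?enorm_ge0.
apply: le_trans (f_lip _ _) _.
by rewrite ler_wpM2r ?enorm_ge0// ler_norm.
Qed.

Lemma cluster_exists : exists2 p, X p &
  forall e : R, 0 < e -> forall N, exists2 k, (N <= k)%N & enorm (x k - p) < e.
Proof.
have [M [_ HM]] := x_bounded.
have cB : compact [set v : V | forall i, v ord0 i \in `[- (M + 1), M + 1]].
  by apply: (@rV_compact _ _ (fun=> `[- (M + 1), M + 1]%classic)) => i; exact: segment_compact.
have xB : (x @ \oo) [set v : V | forall i, v ord0 i \in `[- (M + 1), M + 1]].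
  have M1 : M < M + 1 by rewrite ltrDl.
  exists 0%N => // k _ i; have := HM _ M1 (x k) (ex_intro2 _ _ k I erefl).
  by move=> /(le_trans (coord_le_norm (x k) i)); rewrite ler_norml => H; rewrite in_itv.
have [p [_ clp]] := cB (x @ \oo) _ xB.
have freq e : 0 < e -> forall N, exists2 k, (N <= k)%N & enorm (x k - p) < e.
  move=> e0 N.
  have A : (x @ \oo) (x @` [set k | (N <= k)%N]).
    by exists N => // k Nk; exists k.
  have [y [[k Nk <-] yp]] := clp _ _ A (near_enorm p e0).
  by exists k.
exists p => //; rewrite (closure_id X).1//; move=> B /nbhs_enormP[e e0 HB].
have [k _ ek] := freq e e0 0%N; exists (x k); split; first exact: iterate_in.
exact: HB.
Qed.

(** * Convergence to a cluster point *)
Section ClusterPoint.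
Variable p : V.
Hypothesis Xp : X p.
Hypothesis p_cluster : forall e : R, 0 < e ->
  forall N, exists2 k, (N <= k)%N & enorm (x k - p) < e.

Local Notation e k := (enorm (x k - p)).
Local Notation r k := (F (x k) - F p).

Lemma dist_up k : e k.+1 <= e k + d k.
Proof. by rewrite [leRHS]addrC; exact: ler_enormB_trans. Qed.

Lemma dist_down k : e k <= e k.+1 + d k.
Proof. by rewrite [leRHS]addrC (enormBC (x k.+1) (x k)); exact: ler_enormB_trans. Qed.

Lemma step_ge0 k : 0 <= d k. Proof. exact: enorm_ge0. Qed.

Lemma gap_descent k : mu_low / 2 * d k ^+ 2 <= r k - r k.+1.
Proof. by have := iterate_descent k; lra. Qed.

Lemma descent_coef_gt0 : 0 < mu_low / 2. Proof. by rewrite divr_gt0. Qed.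

Lemma objective_decr j k : F (x (j + k)%N) <= F (x j).
Proof.
elim: k => [|k IH]; first by rewrite addn0.
apply: le_trans IH; rewrite addnS -subr_ge0; apply: le_trans (iterate_descent _).
by rewrite mulr_ge0 ?sqr_ge0// ltW// descent_coef_gt0.
Qed.

Lemma objective_near_cluster eps : 0 < eps ->
  exists2 rho, 0 < rho & forall u, enorm (u - p) < rho -> `|F p - F u| < eps.
Proof.
move=> eps0; apply: nbhs_enormP.
exact: ((@cvgrPdist_lt _ _ _ (nbhs p) (nbhs_filter p) _ _).1 (objective_continuous Xp)).
Qed.

(** If F(x^k) < F(p), later iterates, which do not exceed F(x^k), could not
    have values close to F(p). *)
Lemma gap_ge0 k : 0 <= r k.
Proof.
rewrite leNgt; apply/negP => rk.
have [|rho rho0 H] := @objective_near_cluster (F p - F (x k)); first lra.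
have [j kj ej] := p_cluster rho0 k; have := H _ ej; rewrite ltr_norml => /andP[_].
by have := objective_decr k (j - k); rewrite subnKC//; lra.
Qed.

Lemma gap_lim eps : 0 < eps -> \forall k \near \oo, r k < eps.
Proof.
move=> eps0; have [rho rho0 H] := objective_near_cluster eps0.
have [j _ ej] := p_cluster rho0 0%N; exists j => // k /= jk.
have := H _ ej; rewrite ltr_norml => /andP[A _].
by have := objective_decr j (k - j); rewrite subnKC//; lra.
Qed.

(** If x^k is close to p and the step d_k is small, then x^{k+1} is close to p
    and the residual, at most C d_k, is small. *)
Lemma cluster_approach eps : 0 < eps -> exists k, [/\ e k.+1 < eps,
  enorm (residual (a_ k) (b_ k) (x k.+1)) < eps & r k.+1 < eps].
Proof.
move=> eps0; have [C [rho [C0 rho0 HC]]] := residual_bound Xp.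
have m0 : 0 < Num.min (Num.min (eps / 2) (rho / 2)) (eps / C).
  by rewrite !lt_min !divr_gt0.
have [N _ HN] := filterI (step_lim (d := fun k => d k) (r := fun k => r k)
   descent_coef_gt0 step_ge0 gap_ge0 gap_descent gap_lim m0) (gap_lim eps0).
have m1 : 0 < Num.min (eps / 2) (rho / 2) by rewrite !lt_min !divr_gt0.
have [k Nk] := p_cluster m1 N; rewrite lt_min => /andP[ek1 ek2].
have [] := HN k Nk; rewrite !lt_min => /andP[/andP[dk1 dk2] dk3] _.
have [_ rk] := HN k.+1 (leqW Nk).
have eup := dist_up k; exists k; split=> //; first lra.
apply: le_lt_trans (HC k _ _) _; [lra|lra|].
by rewrite mulrC -ltr_pdivlMr.
Qed.

Lemma cluster_critical : critical_point X f g h D L (lift p).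
Proof.
apply: stationary_critical => //; apply: stationary_of_approach => // eps eps0.
have [k [A B _]] := cluster_approach eps0.
by exists (x k.+1), (a_ k), (b_ k); split=> //; exact: iterate_variational_ineq.
Qed.

Lemma iterate_frechet k :
  frechet_subdiff (phi X f g h) (lift (x k.+1)) (residual (a_ k) (b_ k) (x k.+1)).
Proof.
apply: residual_frechet; [exact: iterate_in| |exact: iterate_variational_ineq].
by move=> i; apply: derive_h_ge0; exact: iterate_in.
Qed.

Lemma cluster_dom : limiting_subdiff (phi X f g h) (lift p) !=set0.
Proof.
exists 0; apply: (limiting_subdiff_zero (phi_lift Xp)) => eps eps0.
have FF : Filter (nbhs p) by exact: nbhs_filter.
have [rho rho0 Hrho] := nbhs_enormP (near_lift p eps0).
have m0 : 0 < Num.min eps rho by rewrite lt_min eps0.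
have [k [A B Ck]] := cluster_approach m0; move: A B Ck; rewrite !lt_min.
move=> /andP[A1 A2] /andP[B1 _] /andP[C1 _].
exists (lift (x k.+1)), (residual (a_ k) (b_ k) (x k.+1)), (F (x k.+1)); split=> //.
- exact: iterate_frechet.
- exact: Hrho.
- exact: phi_lift (iterate_in _).
- by rewrite ger0_norm// gap_ge0.
Qed.

(** The neighbourhood of the KL property at (p, g(p)) is pulled back to a ball
    around p by continuity of x |-> (x, g(x)), and the distance from 0 to the
    limiting subdifferential is at most the norm of the residual. *)
Lemma KL_along_iterates psi : KL_with (phi X f g h) (lift p) psi ->
  exists (C rho : R) (tau : \bar R), [/\ 0 < C, 0 < rho, (0 < tau)%E,
    desingularizing tau psi &
    forall k, e k < rho -> e k.+1 < rho -> 0 < r k.+1 -> ((r k.+1)%:E < tau)%E ->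
      1 <= derive1 psi (r k.+1) * (C * d k)].
Proof.
move=> [tau [W [tau0 nW desing KL]]].
have [C [rho1 [C0 rho10 HC]]] := residual_bound Xp.
have [s s0 Hs] := nbhs_enormP nW.
have [rho2 rho20 H2] := nbhs_enormP (near_lift p s0).
exists C, (Num.min rho1 rho2), tau; split=> //; first by rewrite lt_min rho10.
move=> k; rewrite !lt_min => /andP[ek1 ek2] /andP[fk1 fk2] rp rt.
have [_ _ _ _ /(_ _ rp rt)[_ _ psip]] := desing.
have := KL (lift (x k.+1)) (Hs _ (H2 _ fk2)).
rewrite !phi_lift//; last exact: iterate_in.
rewrite lte_fin -EFinB /= -subr_gt0 => /(_ rp) H.
have {}H := H _; rewrite -lee_fin; apply: le_trans (H _) _.
  case: (tau) tau0 rt => [t _| _ _|]//; last by rewrite addey// ltry.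
  by rewrite -EFinD !lte_fin; lra.
rewrite EFinM lee_pmul2l ?lte_fin//.
apply: le_trans (dist0_le (frechet_limiting (iterate_frechet k))) _.
by rewrite lee_fin; exact: HC.
Qed.

Lemma iterates_converge psi : KL_with (phi X f g h) (lift p) psi -> x @ \oo --> p.
Proof.
move=> /KL_along_iterates[C [rho [tau [C0 rho0 tau0 desing KL]]]].
apply: cvg_enormP => eps eps0.
have [N _ HN] := KL_capture (e := fun k => e k) (d := fun k => d k)
  (r := fun k => r k) descent_coef_gt0 step_ge0 gap_ge0 gap_descent dist_up
  gap_lim C0 rho0 p_cluster
  tau0 desing KL eps0.
by exists N => k Nk; exact: HN.
Qed.

Lemma values_converge :
  phi X f g h (lift (x k)) @[k --> \oo] --> (F p)%:E.
Proof.
have E : (fun k => phi X f g h (lift (x k))) = (fun k => (F (x k))%:E).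
  by apply/funext => k; rewrite phi_lift//; exact: iterate_in.
rewrite E; apply: cvg_EFin; first by near=> k.
apply/cvgrPdist_lt => eps eps0 /=; have := gap_lim eps0; apply: filterS => k.
by rewrite distrC ger0_norm// gap_ge0.
Unshelve. all: by end_near. Qed.

Lemma dist_ge0 k : 0 <= e k. Proof. exact: enorm_ge0. Qed.

Lemma value_gap k : (phi X f g h (lift (x k)) - (F p)%:E = (r k)%:E)%E.
Proof. by rewrite phi_lift//; exact: iterate_in. Qed.

Lemma cluster_rates theta c : 0 <= theta -> theta < 1 -> 0 < c ->
  KL_with (phi X f g h) (lift p) (fun s => c * s `^ (1 - theta)) ->
  KL_rates theta (fun k => e k) (fun k => r k).
Proof.
move=> th0 th1 c0 /KL_along_iterates[C [rho [tau [C0 rho0 tau0 desing KL]]]].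
exact: (power_KL_rates (d := fun k => d k) descent_coef_gt0 dist_ge0
  step_ge0 gap_ge0 gap_descent dist_up
  dist_down gap_lim C0 rho0 c0 th0 th1 p_cluster tau0 desing KL).
Qed.

End ClusterPoint.

Lemma KL_convergence :
  (forall w, limiting_subdiff (phi X f g h) w !=set0 -> KL_property (phi X f g h) w) ->
  exists2 p, X p & [/\ x @ \oo --> p, critical_point X f g h D L (lift p),
    phi X f g h (lift (x k)) @[k --> \oo] --> (F p)%:E,
    forall k, (phi X f g h (lift (x k)) - (F p)%:E = `|F (x k) - F p|%:E)%E &
    forall theta : R, 0 <= theta -> theta < 1 ->
      (forall w, limiting_subdiff (phi X f g h) w !=set0 -> exists2 c, 0 < c &
         KL_with (phi X f g h) w (fun s => c * s `^ (1 - theta))) ->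
      KL_rates theta (fun k => enorm (x k - p)) (fun k => `|F (x k) - F p|)].
Proof.
move=> phi_KL; have [p Xp freq] := cluster_exists; exists p => //.
have dom := cluster_dom Xp freq; have [psi KLp] := phi_KL _ dom.
have rE : (fun k => `|F (x k) - F p|) = (fun k => F (x k) - F p).
  by apply/funext => k; rewrite ger0_norm//; exact: (gap_ge0 Xp freq).
split.
- exact: (@iterates_converge p Xp freq psi KLp).
- exact: cluster_critical Xp freq.
- exact: values_converge Xp freq.
- by move=> k; rewrite value_gap (congr1 (fun s : nat -> R => s k) rE).
- move=> theta th0 th1 /(_ _ dom)[c c0 KLc]; rewrite rE.
  exact: (@cluster_rates p Xp freq theta c th0 th1 c0 KLc).
Qed.

End DCA.

Theorem theorem2 (R : realType) (m : nat) (n_ : 'I_m -> nat)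
    (X : set 'rV[R]_(\sum_i n_ i)) (f : 'rV[R]_(\sum_i n_ i) -> R) (L : R)
    (g : forall i, 'rV[R]_(n_ i) -> R)
    (D : 'I_m -> set R) (h : 'I_m -> R -> R)
    (eta delta mu_low : R)
    (x : nat -> 'rV[R]_(\sum_i n_ i)) (xi : nat -> 'rV[R]_m) (mu : nat -> R)
    (X_closed : closed X) (X_convex : convex_set X)
    (f_diff : forall u, differentiable f u)
    (f_C1 : continuous (gradient f))
    (L_ge0 : 0 <= L)
    (f_lip : forall u v,
      enorm (gradient f u - gradient f v) <= L * enorm (u - v))
    (g_cont : forall i, continuous (g i))
    (g_convex : forall i, convex_function setT (g i))
    (D_open : forall i, open (D i))
    (D_itv : forall i, is_interval (D i))
    (D_unbounded : forall i, ~ has_ubound (D i))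
    (D_g : forall i u, X u -> D i (g i (submxrow u i)))
    (h_concave : forall i, convex_function (D i) (fun t => - h i t))
    (h_incr : forall i s t, D i s -> D i t -> s <= t -> h i s <= h i t)
    (h_subdiff : forall i u t, X u -> g i (submxrow u i) <= t ->
      subdiff ( *%R ) (neg_ext h D i) t `<=` [set y | y <= 0])
    (phi_bounded : (-oo < ereal_inf (range (phi X f g h)))%E)
    (h_derivable : forall i t, D i t -> derivable (h i) t 1)
    (h_loclip : forall i t, D i t ->
      exists2 V, nbhs t V & [lipschitz derive1 (h i) s | s in V])
    (phi_KL : forall w, limiting_subdiff (phi X f g h) w !=set0 ->
      KL_property (phi X f g h) w)
    (eta_gt1 : 1 < eta) (delta_gt0 : 0 < delta) (delta_lt1 : delta < 1)
    (mu_low_gt0 : 0 < mu_low)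
    (x_gen : DCA_like X f g h D eta delta mu_low x xi mu)
    (x_bounded : bounded_set (range x)) :
  exists (xs : 'rV[R]_(\sum_i n_ i)) (phis : R),
    [/\ x @ \oo --> xs,
        critical_point X f g h D L (lift_pt g xs),
        phi X f g h (lift_pt g (x k)) @[k --> \oo] --> phis%:E &
        forall theta : R, 0 <= theta -> theta < 1 ->
          (forall w, limiting_subdiff (phi X f g h) w !=set0 ->
             exists2 c : R, 0 < c &
               KL_with (phi X f g h) w (fun s => c * s `^ (1 - theta))) ->
          [/\ theta = 0 ->
                exists N : nat, forall k, (N <= k)%N ->
                  x k = xs /\ phi X f g h (lift_pt g (x k)) = phis%:E,
              0 < theta -> theta <= 1 / 2 ->
                (exists C q : R, [/\ 0 < C, 0 < q, q < 1 &
                   forall k, enorm (x k - xs) <= C * q ^+ k]) /\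
                (exists C q : R, [/\ 0 < C, 0 < q, q < 1 &
                   forall k, (`|phi X f g h (lift_pt g (x k)) - phis%:E|
                                <= (C * q ^+ k)%:E)%E]) &
              1 / 2 < theta ->
                exists (delta1 delta2 : R) (N0 : nat),
                  [/\ 0 < delta1, 0 < delta2, (0 < N0)%N &
                      forall k, (N0 <= k)%N ->
                        enorm (x k - xs) <=
                          delta1 * k%:R `^ (- ((1 - theta) / (2 * theta - 1)))
                        /\
                        (phi X f g h (lift_pt g (x k)) - phis%:E <=
                          (delta2 * k%:R `^ (- (1 / (2 * theta - 1))))%:E)%E]]].
Proof.
have [p Xp [cvx crit cvphi gap rts]] := KL_convergence X_convex f_diff f_lip g_cont
  g_convex D_open D_g h_concave h_derivable h_subdiff h_loclip X_closed f_C1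
  eta_gt1 delta_lt1 mu_low_gt0 x_gen x_bounded phi_KL.
exists p, (f p + \sum_i h i (g i (submxrow p i))); split=> // theta th0 th1 KLw.
have [R1 R2 R3] := rts theta th0 th1 KLw; split.
- move=> /R1[N HN]; exists N => k Nk; have [ek _] := HN k Nk.
  have xp : x k = p by apply/subr0_eq/enorm_eq0.
  by split=> //; rewrite xp phi_lift.
- move=> t0 t1; have [C [q [C0 q0 q1 H]]] := R2 t0 t1.
  split; exists C, q; split=> // k; have [A B] := H k => //.
  by rewrite gap abse_EFin lee_fin normr_id.
- move=> /R3[d1 [d2 [N0 [d10 d20 N00 H]]]]; exists d1, d2, N0; split=> // k Nk.
  by have [A B] := H k Nk; split=> //; rewrite gap lee_fin.
Qed.
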